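(* (1) For every planar cubic graph $G$ with $E$ edges, the flow polynomial $F_G$ satisfies $$F_G(0)\equiv 3^E\,F_G(4)^2 \pmod 5.$$ (2) More generally, let $G$ be a ribbon cubic graph in $\mathbb{R}^3$ with $V$ vertices and $E$ edges. Then the Yamada polynomial $R_G$ satisfies $$R_G(-1)\equiv(-1)^{V-E}\,3^E\,R_G(1)^2 \pmod 5.$$
   Context: Flow polynomial. For a finite graph $H$ (loops and multiple edges allowed), $F_H(Q)=\sum_{A\subseteq E(H)}(-1)^{|E(H)|-|A|}Q^{|A|-|V(H)|+c(A)}$, where $c(A)$ is the number of connected components of the spanning subgraph $(V(H),A)$. A vertex-free circle component is treated as one vertex with one loop (it contributes a factor $Q-1$). A cubic graph is one with all vertices of degree $3$. Ribbon graphs in $\mathbb{R}^3$. A ribbon graph is a graph $G$ with a $2$-dimensional thickening, encoded by a cyclic ordering of the half-edges at each vertex; a ribbon graph in $\mathbb{R}^3$ is such a thickened graph embedded in $\mathbb{R}^3$, up to isotopy. It is represented by a planar diagram: a generic immersion of $G$ in the plane, whose only singularities are transverse double points in the interiors of edges with over/under information, the ribbon being the planar (blackboard) thickening. Yamada polynomial. $R_G(q)\in\mathbb{Z}[q,q^{-1}]$ is computed from a planar diagram as follows. If the diagram has no crossings, i.e. it is a planar graph $H$, then $R_H(q)=(-1)^{|V(H)|-|E(H)|}F_H(q+2+q^{-1})$; this is equivalent to the contraction-deletion rule $R_H=R_{H/e}+R_{H\smallsetminus e}$ for non-loop edges $e$, together with the rule that adding a disjoint circle multiplies $R$ by $q+1+q^{-1}$,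 that $R_{G\vee H}=-R_GR_H$, and multiplicativity under disjoint union. In general, at each crossing, $R=q\,R_{0}+R_{\times}+q^{-1}R_{1}$, where the three diagrams differ from the original only near the crossing: ''$0$'' is the smoothing joining the two regions swept out when the over-strand is rotated counterclockwise until it meets the under-strand, ''$1$'' is the other planar smoothing, and ''$\times$'' replaces the crossing by a $4$-valent vertex. (The opposite convention for the two smoothings replaces $q$ by $q^{-1}$.) $R_G$ is an isotopy invariant of the ribbon graph $G$ in $\mathbb{R}^3$. *)

(* Defs.v *)
From HB Require Import structures.
From mathcomp Require Import all_boot all_order all_algebra.

Set Implicit Arguments.
Unset Strict Implicit.
Unset Printing Implicit Defensive.
Import GRing.Theory.
Local Open Scope ring_scope.

(* Loops and multiple edges are allowed: an edge is the set of its two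
   half-edges, and a loop has both half-edges based at the same vertex.
   [gcircles] is the number of vertex-free circle components, which count
   neither in [gvertex] nor in [gedges]. *)
Record graph := Graph {
  gvertex : finType;
  ghalf : finType;
  gbase : ghalf -> gvertex;
  gedges : {set {set ghalf}};
  gcircles : nat
}.

Definition is_graph (G : graph) : Prop :=
  partition (gedges G) [set: ghalf G] /\
  (forall e, e \in gedges G -> #|e| = 2%N).

Definition degree (G : graph) (v : gvertex G) : nat :=
  #|[set h | gbase h == v]|.

Definition cubic (G : graph) : Prop := forall v : gvertex G, degree v = 3%N.

Definition adjacent (G : graph) (A : {set {set ghalf G}}) : rel (gvertex G) :=
  [rel u v | [exists e in A, (u \in @gbase G @: e) && (v \in @gbase G @: e)]].

Definition ncomponents (G : graph) (A : {set {set ghalf G}}) : nat :=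
  n_comp (adjacent A) predT.

(* The exponent |A| - |V| + c(A) is never negative, so the truncated
   subtraction is exact.  A circle, seen as one vertex with one loop,
   contributes the factor Q - 1. *)
Definition flow_poly (G : graph) : {poly int} :=
  ('X - 1) ^+ gcircles G *
  \sum_(A : {set {set ghalf G}} | A \subset gedges G)
    (-1) ^+ (#|gedges G| - #|A|) *:
    'X^(#|A| + ncomponents A - #|gvertex G|).

(* Euler's formula for the combinatorial map with darts [T], rotation [rot] at
   the vertices and edge involution [mate].  Here #|T| = 2 E, so this says
   V - E + F = 2 C: each of the C components is drawn on its own sphere.  The
   faces in which the components are then placed in the plane are not recorded;
   neither the flow nor the Yamada polynomial depends on them. *)
Definition genus0 (T : finType) (rot mate : T -> T) : Prop :=
  (fcard rot predT + fcard mate predT + fcard (rot \o mate) predT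
   = #|T| + 2 * n_comp [rel x y | (y == rot x) || (y == mate x)] predT)%N.

(* [rot] cyclically permutes the half-edges at each vertex. *)
Definition is_rotation (V H : finType) (base : H -> V) (rot : H -> H) : Prop :=
  forall h h', fconnect rot h h' = (base h == base h').

Definition is_matching (T : finType) (mate : T -> T) : Prop :=
  involutive mate /\ (forall h, mate h != h).

Definition planar (G : graph) : Prop :=
  exists rot mate : ghalf G -> ghalf G,
    [/\ is_rotation (@gbase G) rot,
        is_matching mate,
        gedges G = [set [set h; mate h] | h : ghalf G]
      & genus0 rot mate].

(* Planar diagrams of ribbon graphs, as decorated combinatorial maps.  [drot]
   is the counterclockwise order of the half-edges at each vertex, i.e. the
   ribbon structure.  The four strand ends at a crossing [x] are
   (x, 0), (x, 1), (x, 2), (x, 3) in counterclockwise order; (x, 1) and (x, 3)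
   are the ends of the over-strand, (x, 0) and (x, 2) those of the
   under-strand.  [darc] matches the two ends of each arc of the diagram.
   [dcircles] counts the circle components without vertex or crossing. *)
Record diagram := Diagram {
  dvertex : finType;
  dhalf : finType;
  dbase : dhalf -> dvertex;
  drot : dhalf -> dhalf;
  crossing : finType;
  darc : (dhalf + crossing * 'I_4)%type -> (dhalf + crossing * 'I_4)%type;
  dcircles : nat
}.

Definition dend (D : diagram) : finType := (dhalf D + crossing D * 'I_4)%type.

Definition turn (D : diagram) (d : dend D) : dend D :=
  match d with
  | inl h => inl (drot h)
  | inr (x, i) => inr (x, ordS i)
  end.

Definition is_diagram (D : diagram) : Prop :=
  [/\ is_rotation (@dbase D) (@drot D),
      is_matching (@darc D : dend D -> dend D)
    & genus0 (@turn D) (@darc D : dend D -> dend D)].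

(* What to put in place of a crossing: a 4-valent vertex ([None]), or two
   strands joining the four ends as told by an involution of 'I_4. *)
Definition tangle := option ('I_4 -> 'I_4).

Definition joined (D : diagram) (p : crossing D -> tangle) : rel (dend D) :=
  [rel d d' | (d' == darc d) ||
    match d with
    | inl _ => false
    | inr (x, i) => if p x is Some g then d' == inr (x, g i) else false
    end].

Definition strands (D : diagram) (p : crossing D -> tangle) :
  {set {set dend D}} := [set [set d' | connect (joined p) d d'] | d : dend D].

Section Resolve.
Variables (D : diagram) (p : crossing D -> tangle).

Definition new_vertex : finType := {x : crossing D | ~~ isSome (p x)}.
Definition rvertex : finType := (dvertex D + new_vertex)%type.
Definition rhalf : finType := (dhalf D + new_vertex * 'I_4)%type.

Definition rbase (h : rhalf) : rvertex :=
  match h with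
  | inl h => inl (dbase h)
  | inr (x, _) => inr x
  end.

Definition rend (h : rhalf) : dend D :=
  match h with
  | inl h => inl h
  | inr (x, i) => inr (val x, i)
  end.

Definition strand_halves (S : {set dend D}) : {set rhalf} :=
  [set h | rend h \in S].

(* A strand meeting a vertex has two ends at vertices and is an edge; the
   others have closed up into vertex-free circles. *)
Definition resolve : graph :=
  @Graph rvertex rhalf rbase
    ((strand_halves @: strands p) :\ set0)
    (dcircles D + #|[set S in strands p | strand_halves S == set0]|).

End Resolve.

(* The abstract graph carried by the diagram: strands go straight through the
   crossings. *)
Definition underlying (D : diagram) : graph :=
  resolve (fun _ : crossing D => Some (fun i => ordS (ordS i))).

(* Rotating the over-strand {1, 3} counterclockwise onto the under-strand
   {0, 2} sweeps the regions between the ends 1 and 2 and between the ends 3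
   and 0.  Joining these two regions connects 0 with 1 and 2 with 3; the other
   smoothing connects 1 with 2 and 3 with 0. *)
Definition smooth0 (i : 'I_4) : 'I_4 := if odd i then ord_pred i else ordS i.
Definition smooth1 (i : 'I_4) : 'I_4 := if odd i then ordS i else ord_pred i.

(* [Some false] is the smoothing 0, [Some true] the smoothing 1 and [None] the
   4-valent vertex. *)
Definition state (D : diagram) := {ffun crossing D -> option bool}.

Definition state_graph (D : diagram) (s : state D) : graph :=
  resolve (fun x => omap (fun b : bool => if b then smooth1 else smooth0)
                         (s x)).

Definition state_degree (D : diagram) (s : state D) : int :=
  #|[set x | s x == Some false]|%:Z - #|[set x | s x == Some true]|%:Z.

Section Yamada.
Variable A : comUnitRingType.

Definition planar_yamada (H : graph) (q : A) : A :=
  (-1) ^ (#|gvertex H|%:Z - #|gedges H|%:Z) *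
  (map_poly intr (flow_poly H)).[q + 2 + q^-1].

(* The value at a unit [q] of [A] of the Yamada polynomial, a Laurent
   polynomial over the integers; the relation R = q R_0 + R_x + q^-1 R_1 is
   applied at all the crossings. *)
Definition yamada (D : diagram) (q : A) : A :=
  \sum_(s : state D) q ^ state_degree s * planar_yamada (state_graph s) q.

End Yamada.

(* Main.v *)
Require Import Defs.
From mathcomp Require Import all_boot all_order all_algebra all_fingroup.
From mathcomp Require Import zify ring.

Set Implicit Arguments.
Unset Strict Implicit.
Unset Printing Implicit Defensive.
Import GRing.Theory.
Local Open Scope ring_scope.

(** Modulo 5, the two values R(-1) and R(1)^2 are contractions of tensors along
    the arcs of the diagram that differ by tensors which no contraction sees.

    A commutative Frobenius algebra with handle element Q has a state sum on
    graphs, and this state sum is the flow polynomial at Q up to sign: summing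
    over the label of an edge is contraction-deletion ([network_expansion]).
    Two such systems of labels are used over the ring F5 of integers modulo 5.
    With Q = 4 the labels are three colours, and for a cubic graph the state sum
    counts the 3-edge-colourings.  With Q = 0 the labels are spins: one scalar and
    the three coordinates of a vector.  Over the integers the flow polynomial at
    0 counts spanning forests with signs, which is a model with one scalar and
    two anticommuting coordinates; every closed line of vectors then counts -2,
    and modulo 5 three commuting coordinates do the same.  For a diagram, the
    skein relation adds up separately at each crossing ([yamada_network]).

    At q = 1 the genus enters.  In a map of genus 0 the number of boundary
    components of a set of edges is determined by its cycle rank
    ([orbits_faces]), and 4 is the square of 2; so the colour sum is also a sum
    over 2-valued functions on the corners of the map, and the vertices become
    traces of products of Pauli matrices ([spherical_colorings]).  For these
    the three terms of the skein relation add up to two strands that cross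
    freely ([state_traceE]).  Hence R(1) is the sum, over the 3-edge-colourings
    of the abstract graph, of the product of the orientations of the three
    colours at the vertices ([yamada_at_1]).

    The Lie algebra so(3) acts on both systems of labels and all the tensors are
    invariant; a contraction does not change when an invariant tensor is
    modified by a sum of derivatives ([replace_tensors]).  Modulo 5, and not over
    the integers, the sum of the three pairings of four vectors is such a sum of
    derivatives: its contraction with a pairing is 9 + 3 + 3 = 15.  At q = -1 this
    makes the crossings free ([yamada_at_m1]).  The square of R(1) is a
    contraction over pairs of colours, that is over 3 x 3 matrices, whose vertex
    is the polarized determinant ([network_square]).  There, the same fact allows
    each arc to carry only the sum of a scalar matrix and an antisymmetric one;
    what is dropped, the symmetric matrices of trace 0, has dimension 5.  The
    determinant of s I + [v] is s^3 + s |v|^2, which up to scaling is the vertex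
    of the spins, and so the two contractions agree up to a power of 3 and a sign
    ([network_projector], [yamada_square]).

    A planar graph is a diagram without crossings, and its values at q = -1 and
    q = 1 are, up to sign, those of the flow polynomial at 0 and 4. *)

(** * Connected components *)

Lemma subset_ind (I : finType) (P : {set I} -> Prop) :
  P set0 -> (forall (A : {set I}) i, i \notin A -> P A -> P (i |: A)) -> forall A, P A.
Proof.
move=> P0 PU A; have [n] := ubnP #|A|; elim: n A => // n IH A.
case: (set_0Vmem A) => [-> //|[i iA]]; rewrite (cardsD1 i) iA ltnS => An.
by rewrite -(setD1K iA); apply: PU (IH _ An); rewrite !inE eqxx.
Qed.

Section Components.
Variable T : finType.
Implicit Types (e : rel T) (u v x y : T).

Definition component e x : {set T} := [set y | connect e x y].
Definition components e : {set {set T}} := [set component e x | x : T].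

Lemma mem_components e x : component e x \in components e.
Proof. by apply/imsetP; exists x. Qed.

Lemma component_id e x : x \in component e x.
Proof. by rewrite inE connect0. Qed.

Lemma eq_component e x y : connect_sym e -> (component e x == component e y) = connect e x y.
Proof.
move=> symE; apply/eqP/idP => [exy | xy].
  by have := component_id e y; rewrite -exy inE.
by apply/setP=> z; rewrite !inE (same_connect symE xy).
Qed.

Lemma component_eqP e x C : connect_sym e -> C \in components e ->
  (x \in C) = (C == component e x).
Proof.
by move=> symE /imsetP[y _ ->]; rewrite eq_component // inE.
Qed.

Lemma eq_components e e' : connect e =2 connect e' -> components e = components e'.
Proof.
move=> ee'; apply: eq_imset => x; apply/setP=> y; by rewrite !inE ee'.
Qed.

Lemma card_components e : connect_sym e -> #|components e| = n_comp e predT.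
Proof.
move=> symE.
have -> : components e = component e @: [set x | x \in [predI roots e & predT]].
  apply/setP=> C; apply/imsetP/imsetP=> -[x Hx ->]; last by exists x.
  exists (fingraph.root e x); first by rewrite !inE roots_root.
  by apply/eqP; rewrite eq_component // connect_root.
rewrite card_in_imset ?cardsE // => x y.
rewrite !inE !andbT => /eqP rx /eqP ry /eqP.
by rewrite eq_component // => /(fingraph.rootP symE); rewrite rx ry.
Qed.

Definition add_edge e u v : rel T :=
  [rel x y | [|| e x y, (x == u) && (y == v) | (x == v) && (y == u)]].

Lemma sub_add_edge e u v x y : connect e x y -> connect (add_edge e u v) x y.
Proof.
by apply: connect_sub => {}x {}y xy; apply: connect1; apply/or3P; constructor 1.
Qed.

Lemma connect_add_edge e u v x y : connect_sym e ->
  connect (add_edge e u v) x y =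
  [|| connect e x y, connect e x u && connect e v y
    | connect e x v && connect e u y].
Proof.
move=> symE; apply/idP/idP.
  case/connectP=> p pth ->{y}; elim/last_ind: p pth => [|p z IH] /=.
    by rewrite connect0.
  rewrite rcons_path last_rcons.
  case/andP=> /IH{}IH /or3P[lz|/andP[/eqP lu /eqP ->]|/andP[/eqP lv /eqP->]].
  - have {}lz := connect1 lz.
    by case/or3P: IH => [H|/andP[H1 H2]|/andP[H1 H2]];
      rewrite ?(connect_trans H lz) ?(connect_trans H2 lz) ?H1 ?orbT.
  - case/or3P: IH => [H|/andP[H1 H2]|/andP[H1 H2]]; rewrite ?connect0 ?andbT.
    + by rewrite -lu H orbT.
    + by rewrite H1 orbT.
    + by rewrite H1.
  - case/or3P: IH => [H|/andP[H1 H2]|/andP[H1 H2]]; rewrite ?connect0 ?andbT.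
    + by rewrite -lv H !orbT.
    + by rewrite H1.
    + by rewrite H1 !orbT.
have uv : connect (add_edge e u v) u v by apply: connect1; rewrite /add_edge /= !eqxx orbT.
have vu : connect (add_edge e u v) v u by apply: connect1; rewrite /add_edge /= !eqxx !orbT.
case/or3P=> [H|/andP[H1 H2]|/andP[H1 H2]]; first exact: sub_add_edge.
  exact: connect_trans (sub_add_edge _ _ H1) (connect_trans uv (sub_add_edge _ _ H2)).
exact: connect_trans (sub_add_edge _ _ H1) (connect_trans vu (sub_add_edge _ _ H2)).
Qed.

Lemma add_edge_sym e u v : connect_sym e -> connect_sym (add_edge e u v).
Proof.
move=> symE x y; rewrite !connect_add_edge //.
rewrite (symE y x) (symE y u) (symE v x) (symE y v) (symE u x).
by rewrite [connect e u y && _]andbC [connect e v y && _]andbC [X in _ || X]orbC.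
Qed.

Lemma components_add_edge_same e u v : connect_sym e -> connect e u v ->
  components (add_edge e u v) = components e.
Proof.
move=> symE uv; apply: eq_components => x y; rewrite connect_add_edge //.
apply/or3P/idP; last by constructor 1.
case=> [//|/andP[xu vy]|/andP[xv uy]].
  exact: connect_trans xu (connect_trans uv vy).
by rewrite symE in uv; exact: connect_trans xv (connect_trans uv uy).
Qed.

Lemma components_add_edge e u v : connect_sym e -> ~~ connect e u v ->
  components (add_edge e u v) =
  (component e u :|: component e v) |: (components e :\ component e u :\ component e v).
Proof.
move=> symE uv; have vu : ~~ connect e v u by rewrite symE.
have compE x : component (add_edge e u v) x =
    if connect e x u || connect e x v then component e u :|: component e v else component e x.
  apply/setP=> y; rewrite inE connect_add_edge //.
  case: ifP => [/orP[xu|xv]|/norP[/negPf -> /negPf ->]]; rewrite ?inE //; last by rewrite orbF.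
    rewrite xu /= (same_connect symE xu).
    have -> : connect e x v = false by rewrite (same_connect symE xu); apply/negbTE.
    by rewrite orbF.
  rewrite xv /= (same_connect symE xv).
  have -> : connect e x u = false by rewrite (same_connect symE xv); apply/negbTE.
  by rewrite orbC.
apply/setP=> C; apply/imsetP/idP => [[x _ ->]|].
  rewrite compE; case: ifP => [_|/norP[xu xv]]; first by rewrite setU11.
  rewrite !inE !eq_component // xu xv mem_components /=.
  by rewrite orbT.
case/setU1P => [->|]; first by exists u; rewrite ?compE ?connect0.
rewrite !inE => /and3P[Cv Cu /imsetP[x _ Cx]]; exists x => //.
by rewrite compE -!eq_component // -Cx (negPf Cv) (negPf Cu).
Qed.

Lemma union_comp_notin e u v : connect_sym e -> ~~ connect e u v ->
  component e u :|: component e v \notin components e :\ component e u :\ component e v.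
Proof.
move=> symE uv; apply/negP; rewrite !inE => /and3P[H1 H2 H3].
have := component_eqP u symE H3; rewrite !inE connect0 /= => /esym.
by move=> E; rewrite E in H2.
Qed.

Lemma card_components_add_edge e u v : connect_sym e ->
  #|components e| = (#|components (add_edge e u v)| + ~~ connect e u v)%N.
Proof.
move=> symE; case: (boolP (connect e u v)) => [uv|uv].
  by rewrite components_add_edge_same // addn0.
rewrite components_add_edge // cardsU1 union_comp_notin //=.
rewrite (cardsD1 (component e u)) mem_components (cardsD1 (component e v)) !inE.
rewrite mem_components andbT eq_component // symE uv /=.
by rewrite addnC.
Qed.

Lemma disjoint_comp e u v : connect_sym e -> ~~ connect e u v ->
  [disjoint component e u & component e v].
Proof.
move=> symE uv; apply/pred0P=> x /=; rewrite !inE; apply/negP=> /andP[ux vx].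
by case/negP: uv; rewrite symE in vx; exact: connect_trans ux vx.
Qed.

End Components.

Section BigComps.
Variables (R : Type) (idx : R) (op : Monoid.com_law idx) (T : finType).

Lemma big_components_split (e : rel T) u v (F : {set T} -> R) :
    connect_sym e -> ~~ connect e u v ->
  \big[op/idx]_(C in components e) F C =
  op (op (F (component e u)) (F (component e v)))
     (\big[op/idx]_(C in components e :\ component e u :\ component e v) F C).
Proof.
move=> symE uv; rewrite (big_setD1 (component e u)) ?mem_components //=.
rewrite (big_setD1 (component e v)) /= ?Monoid.mulmA //.
by rewrite !inE mem_components eq_component // symE uv.
Qed.

Lemma big_components_merge (e : rel T) u v (F : {set T} -> R) :
    connect_sym e -> ~~ connect e u v ->
  \big[op/idx]_(C in components (add_edge e u v)) F C =
  op (F (component e u :|: component e v))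
     (\big[op/idx]_(C in components e :\ component e u :\ component e v) F C).
Proof.
by move=> symE uv; rewrite components_add_edge // big_setU1 // union_comp_notin.
Qed.

Lemma big_components_fibres (e : rel T) (N : finType) (b : T -> N) (F : {set T} -> R) :
    (forall x y, connect e x y = (b x == b y)) ->
  \big[op/idx]_(C in components e) F C =
  \big[op/idx]_(n in b @: T) F [set x | b x == n].
Proof.
move=> eb; have -> : components e = (fun n => [set x | b x == n]) @: (b @: T).
  rewrite -imset_comp; apply: eq_imset => x; apply/setP=> y.
  by rewrite !inE eb eq_sym.
rewrite big_imset // => n n' /imsetP[x _ ->] /imsetP[y _ ->] /setP/(_ x).
by rewrite !inE eqxx => /esym/eqP.
Qed.

End BigComps.

(** * Matchings and their edges *)

Section Matching.
Variables (T : finType) (m : T -> T).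

(** Edges are represented by one of their two ends, the one that the
    enumeration of [T] meets first. *)
Definition first_end : pred T := [pred d | enum_rank d < enum_rank (m d)]%N.
Definition edge : finType := {d : T | first_end d}.

Hypothesis hm : is_matching m.

Lemma matching_invol : involutive m. Proof. by case: hm. Qed.
Lemma matching_inj : injective m. Proof. exact: inv_inj matching_invol. Qed.
Lemma matching_neq d : m d != d. Proof. by case: hm. Qed.

Lemma first_end_m d : first_end (m d) = ~~ first_end d.
Proof.
rewrite /first_end /= matching_invol -leqNgt ltn_neqAle; case: eqP => //= E.
by have := matching_neq d; rewrite (enum_rank_inj (ord_inj E)) eqxx.
Qed.

Lemma edge_of_ex d : {i : edge | (val i == d) || (val i == m d)}.
Proof.
case: (boolP (first_end d)) => Hd; first by exists (Sub d Hd); rewrite SubK eqxx.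
by rewrite -first_end_m in Hd; exists (Sub (m d) Hd); rewrite SubK eqxx orbT.
Qed.
Definition edge_of d : edge := sval (edge_of_ex d).

Lemma val_edge_of d : val (edge_of d) = if first_end d then d else m d.
Proof.
rewrite /edge_of; case: edge_of_ex => i id.
rewrite [sval _]/=; have: first_end (val i) := valP i.
by case/orP: id => /eqP ->; [move=> -> | rewrite first_end_m => /negPf ->].
Qed.

Lemma edge_of_val i : edge_of (val i) = i.
Proof.
have Hi : first_end (val i) := valP i.
by apply: val_inj; rewrite val_edge_of Hi.
Qed.

Lemma edge_of_m d : edge_of (m d) = edge_of d.
Proof.
apply: val_inj; rewrite !val_edge_of first_end_m.
by case: (first_end d) => //=; rewrite matching_invol.
Qed.

Lemma edge_of_m_val i : edge_of (m (val i)) = i.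
Proof. by rewrite edge_of_m edge_of_val. Qed.

Lemma edge_of_eq d i : (edge_of d == i) = (d == val i) || (d == m (val i)).
Proof.
apply/eqP/orP => [<-|[/eqP ->|/eqP ->]]; rewrite ?edge_of_val ?edge_of_m_val //.
by rewrite val_edge_of; case: ifP => _; [left|right; rewrite matching_invol].
Qed.

Lemma big_matching R (idx : R) (op : Monoid.com_law idx) (F : T -> R) :
  \big[op/idx]_d F d = \big[op/idx]_(i : edge) op (F (val i)) (F (m (val i))).
Proof.
rewrite (bigID first_end) /= big_split /=; congr (op _ _).
  by rewrite (big_sub first_end F).
rewrite (reindex_inj matching_inj) /=.
rewrite (eq_bigl first_end) => [|d]; last by rewrite first_end_m negbK.
by rewrite (big_sub first_end (fun d => F (m d))).
Qed.

Lemma card_matching : #|T| = (2 * #|{: edge}|)%N.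
Proof.
rewrite -sum1_card (big_matching _ (fun=> 1%N)) sum_nat_const.
by rewrite mulnC.
Qed.

Section Invariant.
Variable L : finType.

Definition minv (l : {ffun T -> L}) : bool := [forall d, l (m d) == l d].

Lemma minvP (l : {ffun T -> L}) : reflect (forall d, l (m d) = l d) (minv l).
Proof. exact: 'forall_eqP. Qed.

Lemma minv_edge_of (f : {ffun edge -> L}) : minv [ffun d => f (edge_of d)].
Proof. by apply/minvP=> d; rewrite !ffunE edge_of_m. Qed.

Lemma minv_val (l : {ffun T -> L}) d : minv l -> l (val (edge_of d)) = l d.
Proof. by move/minvP=> ml; rewrite val_edge_of; case: ifP. Qed.

Lemma sum_minv (R : nmodType) (G : {ffun T -> L} -> R) :
  \sum_(l | minv l) G l =
  \sum_(f : {ffun edge -> L}) G [ffun d => f (edge_of d)].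
Proof.
rewrite (reindex_onto (fun f : {ffun edge -> L} => [ffun d => f (edge_of d)])
  (fun l => [ffun i => l (val i)])) /=; last first.
  by move=> l ml; apply/ffunP=> d; rewrite !ffunE minv_val.
apply: eq_bigl => f; rewrite minv_edge_of; apply/eqP/ffunP=> i.
by rewrite !ffunE edge_of_val.
Qed.

Lemma prod_edge_expand (R : comNzRingType) (F : L -> T -> R) :
  \prod_(i : edge) \sum_(w : L) F w (val i) * F w (m (val i)) =
  \sum_(l | minv l) \prod_d F (l d) d.
Proof.
rewrite bigA_distr_bigA sum_minv; apply: eq_bigr => f _.
rewrite big_matching; apply: eq_bigr => i _.
by rewrite !ffunE edge_of_val edge_of_m_val.
Qed.

End Invariant.
End Matching.

(** * Contraction-deletion for label networks *)

Section Engine.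
Variables (R : comNzRingType) (M : nmodType) (L : finType) (x : L -> M).
Variables (t : M -> R) (Q : R).
Hypothesis t_link : forall a b,
  \sum_l t (a + x l) * t (b + x l) = t (a + b) + t a * t b.
Hypothesis t_loop : forall a, \sum_l t (a + x l + x l) = (1 - Q) * t a.
Hypothesis t0 : t 0 = -1.

Variables (V : finType) (e0 : rel V) (I : finType) (p : I -> V * V).
Hypothesis e0_sym : connect_sym e0.

Definition edge_rel (A : {set I}) : rel V :=
  [rel u v | e0 u v || [exists i in A, (p i == (u, v)) || (p i == (v, u))]].

Lemma edge_rel_add (A : {set I}) i : edge_rel (i |: A) =2 add_edge (edge_rel A) (p i).1 (p i).2.
Proof.
move=> u v; rewrite /edge_rel /add_edge /= -orbA; congr (_ || _).
apply/existsP/idP=> [[j /andP[]]|].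
  rewrite in_setU1 => /orP[/eqP ->|jA pj].
    by case: (p i) => a b /orP[]/eqP[-> ->] /=; rewrite !eqxx ?orbT.
  by apply/orP; left; apply/existsP; exists j; rewrite jA.
case/or3P => [/existsP[j /andP[jA pj]]|/andP[/eqP-> /eqP->]|/andP[/eqP-> /eqP->]].
- by exists j; rewrite in_setU1 jA orbT.
- by exists i; rewrite setU11 -surjective_pairing eqxx.
- by exists i; rewrite setU11 -surjective_pairing eqxx orbT.
Qed.

Lemma edge_rel0 : edge_rel set0 =2 e0.
Proof.
move=> u v; rewrite /edge_rel /=; case: existsP => [[i]|_]; last by rewrite orbF.
by rewrite inE.
Qed.


Lemma edge_rel_sym A : connect_sym (edge_rel A).
Proof.
elim/subset_ind: A => [|A i _ IH] u v; first by rewrite !(eq_connect edge_rel0).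
by rewrite !(eq_connect (edge_rel_add A i)); apply: add_edge_sym.
Qed.

Lemma components_edge_rel0 : components (edge_rel set0) = components e0.
Proof. exact/eq_components/eq_connect/edge_rel0. Qed.

Lemma components_edge_rel_add A i :
  components (edge_rel (i |: A)) = components (add_edge (edge_rel A) (p i).1 (p i).2).
Proof. exact/eq_components/eq_connect/edge_rel_add. Qed.

Lemma card_components_edge_rel (A : {set I}) : (#|components e0| <= #|A| + #|components (edge_rel A)|)%N.
Proof.
elim/subset_ind: A => [|A i iA IH]; first by rewrite components_edge_rel0 leq_addl.
rewrite components_edge_rel_add cardsU1 iA; apply: leq_trans IH _.
rewrite (card_components_add_edge (p i).1 (p i).2 (edge_rel_sym A)).
by case: (~~ _); lia.
Qed.

(** The cycle rank of the graph with edges [A] whose vertices are the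
    components of [e0]. *)
Definition nullity (A : {set I}) :=
  (#|A| + #|components (edge_rel A)| - #|components e0|)%N.

Lemma nullity_add (A : {set I}) i : i \notin A -> nullity (i |: A) =
  (nullity A + connect (edge_rel A) (p i).1 (p i).2)%N.
Proof.
move=> iA; rewrite /nullity components_edge_rel_add cardsU1 iA.
have := card_components_edge_rel A.
rewrite (card_components_add_edge (p i).1 (p i).2 (edge_rel_sym A)).
by case: connect => /=; lia.
Qed.

(** The vertices are the components of [e], and [s] records what has been put
    at each point.  Labels are added up in a monoid because merging two vertices
    must merge their labels. *)
Definition net (e : rel V) (s : V -> M) : R :=
  \prod_(C in components e) t (\sum_(v in C) s v).

Definition put (a : M) (i : I) (v : V) : M :=
  (if v == (p i).1 then a else 0) + (if v == (p i).2 then a else 0).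

Lemma sum_put (C : {set V}) s a i :
  \sum_(v in C) (s v + put a i v) = \sum_(v in C) s v +
    ((if (p i).1 \in C then a else 0) + (if (p i).2 \in C then a else 0)).
Proof.
rewrite big_split /=; congr (_ + _); rewrite big_split /=.
have E u : \sum_(v in C) (if v == u then a else 0) = if u \in C then a else 0.
  case: ifP => uC.
    rewrite (bigD1 u) //= eqxx big1 ?addr0 // => v /andP[_ /negPf -> //].
  by rewrite big1 // => v vC; case: eqP => // E; rewrite -E vC in uC.
by rewrite !E.
Qed.

(** Contraction-deletion: [t_link] is the case of an edge with distinct ends,
    and [t_loop] the case of a loop. *)
Lemma sum_net_put e s i : connect_sym e ->
  \sum_l net e (fun v => s v + put (x l) i v) =
  net e s + (if connect e (p i).1 (p i).2 then - Q else 1) *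
            net (add_edge e (p i).1 (p i).2) s.
Proof.
move=> symE; set u := (p i).1; set v := (p i).2.
have outC C : C \in components e -> C != component e u -> C != component e v ->
    forall l, \sum_(w in C) (s w + put (x l) i w) = \sum_(w in C) s w.
  move=> HC Cu Cv l; rewrite sum_put -/u -/v !(component_eqP _ symE HC).
  by rewrite (negPf Cu) (negPf Cv) !addr0.
case: (boolP (connect e u v)) => uv.
  rewrite {3}/net components_add_edge_same // -/(net e s).
  have cuv : component e v = component e u by apply/eqP; rewrite eq_component // symE.
  have vu : v \in component e u by rewrite inE.
  pose rest := \prod_(C in components e :\ component e u) t (\sum_(w in C) s w).
  have E1 : net e s = t (\sum_(w in component e u) s w) * rest.
    by rewrite /net (big_setD1 (component e u)) ?mem_components.
  under eq_bigr => l _.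
    rewrite /net (big_setD1 (component e u)) ?mem_components //=.
    rewrite sum_put -/u -/v component_id vu addrA.
    rewrite (_ : \prod_(C in _) _ = rest); first over.
    apply: eq_bigr => C; rewrite !inE => /andP[Cu HC]; rewrite outC // cuv //.
  by rewrite -mulr_suml t_loop E1; ring.
have dis := disjoint_comp symE uv.
pose rest := \prod_(C in components e :\ component e u :\ component e v) t (\sum_(w in C) s w).
have -> : net (add_edge e u v) s =
    t (\sum_(w in component e u) s w + \sum_(w in component e v) s w) * rest.
  rewrite /net big_components_merge //=; congr (t _ * _).
  by rewrite -bigU //; apply: eq_bigl => w; rewrite !inE.
have -> : net e s =
    t (\sum_(w in component e u) s w) * t (\sum_(w in component e v) s w) * rest.
  by rewrite /net (big_components_split _ _ symE uv).
have vu' : (v \in component e u) = false by rewrite inE; apply/negbTE.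
have uv' : (u \in component e v) = false by rewrite inE symE; apply/negbTE.
under eq_bigr => l _.
  rewrite /net (big_components_split _ _ symE uv) /= !sum_put -/u -/v !component_id vu' uv'.
  rewrite addr0 add0r.
  rewrite (_ : \prod_(C in _) _ = rest); first over.
  by apply: eq_bigr => C; rewrite !inE => /and3P[Cv Cu HC]; rewrite outC.
by rewrite -mulr_suml t_link; ring.
Qed.

Fixpoint net_edges (r : seq I) (s : V -> M) : R :=
  if r is i :: r' then \sum_l net_edges r' (fun v => s v + put (x l) i v)
  else net e0 s.

Lemma sum_subsets_cons (G : {set I} -> R) i (S : {set I}) : i \notin S ->
  \sum_(A : {set I} | A \subset i |: S) G A =
  \sum_(A : {set I} | A \subset S) (G A + G (i |: A)).
Proof.
move=> iS; rewrite (bigID (fun A : {set I} => i \in A)) /= addrC big_split /=.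
congr (_ + _).
  apply: eq_bigl => A; apply/andP/idP => [[/subsetP AS iA]|AS].
    apply/subsetP=> j jA; have := AS j jA; rewrite in_setU1 => /orP[/eqP ji|//].
    by rewrite -ji jA in iA.
  split; first by apply: subset_trans AS (subsetU1 _ _).
  by apply: contra iS => /(subsetP AS).
rewrite (reindex_onto (fun A => i |: A) (fun A => A :\ i)) /=; last first.
  by move=> A /andP[_ iA]; rewrite setD1K.
apply: eq_bigl => A; rewrite setU11 andbT; apply/andP/idP => [[AS /eqP E]|AS].
  by rewrite -E subDset.
have iA : i \notin A by apply: contra iS => /(subsetP AS).
by rewrite setUS // setU1K.
Qed.

Lemma net_edgesE r s : uniq r ->
  net_edges r s = \sum_(A : {set I} | A \subset [set i in r])
    (- Q) ^+ nullity A * net (edge_rel A) s.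
Proof.
elim: r s => [|i r IH] s /=.
  move=> _; rewrite (_ : [set _ in _] = set0); last by apply/setP=> i; rewrite !inE.
  rewrite (eq_bigl (pred1 set0)) => [|A]; last by rewrite subset0.
  rewrite big_pred1_eq /nullity components_edge_rel0 cards0 add0n subnn expr0 mul1r.
  by rewrite /net components_edge_rel0.
case/andP=> ir ur; rewrite set_cons sum_subsets_cons ?inE //.
under eq_bigr => l _ do rewrite IH //.
rewrite exchange_big /=; apply: eq_bigr => A AS.
have iA : i \notin A by apply: contra ir => /(subsetP AS); rewrite inE.
rewrite -mulr_sumr (sum_net_put _ _ (edge_rel_sym A)) nullity_add // mulrDr.
congr (_ + _); rewrite mulrA /net components_edge_rel_add.
by case: connect; rewrite /= ?addn1 ?addn0 ?mulr1 ?exprSr.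
Qed.

Lemma net_edges_labels r s (f0 : {ffun I -> L}) : uniq r ->
  net_edges r s = \sum_(f : {ffun I -> L} | [forall i, (i \in r) || (f i == f0 i)])
    net e0 (fun v => s v + \sum_(i <- r) put (x (f i)) i v).
Proof.
elim: r s f0 => [|i r IH] s f0 /=.
  rewrite (eq_bigl (pred1 f0)) => [_|f].
    by rewrite big_pred1_eq; apply: eq_bigr => C _; congr t;
       apply: eq_bigr => v _; rewrite big_nil addr0.
  by apply/'forall_eqP/eqP => [E|-> //]; apply/ffunP.
case/andP=> ir ur; rewrite (partition_big (fun f : {ffun _ -> _} => f i) predT) //=.
apply: eq_bigr => l _.
rewrite (IH _ [ffun j => if j == i then l else f0 j]) //.
apply: eq_big => f.
  apply/forallP/andP => [H|[/forallP H /eqP fi] j]; last first.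
    by move: (H j); rewrite in_cons ffunE; case: eqP => [->|//]; rewrite fi eqxx orbT.
  have fi : f i = l by apply/eqP; move: (H i); rewrite (negPf ir) ffunE eqxx.
  split; last by apply/eqP.
  by apply/forallP=> j; move: (H j); rewrite in_cons ffunE; case: (j == i).
move=> H; have fi : f i = l.
  by move/forallP/(_ i): H; rewrite (negPf ir) ffunE eqxx => /eqP.
apply: eq_bigr => C _; congr t; apply: eq_bigr => v _.
by rewrite big_cons fi addrA.
Qed.

(** The hypotheses on [t] say that it is, up to sign, the trace of a commutative
    Frobenius algebra with handle element [Q], restricted to products of labels.
    Each set [A] of edges then contributes one trace for each component and one
    factor [Q] for each independent cycle. *)
Theorem network_expansion (l0 : L) :
  \sum_(f : {ffun I -> L}) net e0 (fun v => \sum_i put (x (f i)) i v) =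
  \sum_(A : {set I}) (- Q) ^+ nullity A * (-1) ^+ #|components (edge_rel A)|.
Proof.
have ur : uniq (enum I) by exact: enum_uniq.
have := net_edgesE (fun=> 0) ur; rewrite (net_edges_labels _ [ffun=> l0] ur) => E.
transitivity (\sum_(A : {set I} | A \subset [set i in enum I])
    (- Q) ^+ nullity A * net (edge_rel A) (fun=> 0)).
  rewrite -E; apply: eq_big => [f|f _].
    by apply/esym/forallP=> i; rewrite mem_enum.
  by apply: eq_bigr => C _; congr t; apply: eq_bigr => v _; rewrite add0r big_enum.
apply: eq_big => [A|A _]; first by apply/subsetP=> i _; rewrite inE mem_enum.
congr (_ * _); rewrite /net -prodr_const; apply: eq_bigr => C _.
by rewrite big1.
Qed.

End Engine.

Section HalfEdges.
Variables (R : comNzRingType) (M : nmodType) (L : finType) (x : L -> M).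
Variables (t : M -> R) (Q : R).
Hypothesis t_link : forall a b,
  \sum_l t (a + x l) * t (b + x l) = t (a + b) + t a * t b.
Hypothesis t_loop : forall a, \sum_l t (a + x l + x l) = (1 - Q) * t a.
Hypothesis t0 : t 0 = -1.
Variables (V : finType) (e0 : rel V) (e0_sym : connect_sym e0).
Variables (H : finType) (base : H -> V) (m : H -> H) (hm : is_matching m).

Definition edge_ends (i : edge m) := (base (val i), base (m (val i))).

Theorem half_edge_expansion (l0 : L) :
  \sum_(l : {ffun H -> L} | minv m l)
    \prod_(C in components e0) t (\sum_(h | base h \in C) x (l h)) =
  \sum_(A : {set edge m}) (- Q) ^+ nullity e0 edge_ends A *
     (-1) ^+ #|components (edge_rel e0 edge_ends A)|.
Proof.
rewrite -(network_expansion t_link t_loop t0 _ e0_sym l0) (sum_minv hm).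
apply: eq_bigr => f _; apply: eq_bigr => C _; congr t.
transitivity (\sum_(v in C) \sum_(h | base h == v) x (f (edge_of hm h))).
  rewrite (partition_big base (mem C)) //=; apply: eq_bigr => v vC.
  apply: eq_big => [h|h _]; last by rewrite ffunE.
  by case: eqP => [->|]; rewrite ?andbF // andbT.
apply: eq_bigr => v _; rewrite big_mkcond (big_matching hm) /=.
apply: eq_bigr => i _; rewrite /put edge_of_val edge_of_m_val /=.
by congr (_ + _); rewrite eq_sym.
Qed.

End HalfEdges.

(** * The two systems of labels *)

Notation F5 := 'Z_5.

Definition color : finType := option bool.

Lemma big_option R (idx : R) (op : Monoid.com_law idx) (T : finType)
    (F : option T -> R) :
  \big[op/idx]_l F l = op (F None) (\big[op/idx]_x F (Some x)).
Proof.
rewrite (bigD1 None) //=; congr (op _ _).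
rewrite (reindex_omap Some id) /=; last by case.
by apply: eq_bigl => x; rewrite eqxx.
Qed.

Lemma sum_color (R : nmodType) (F : color -> R) :
  \sum_c F c = F None + F (Some true) + F (Some false).
Proof. by rewrite big_option big_bool /= addrA. Qed.

Definition counts : nmodType := (nat * nat * nat)%type.

Definition count_color (c : color) : counts :=
  match c with
  | None => (1, 0, 0)
  | Some true => (0, 1, 0)
  | Some false => (0, 0, 1)
  end%N.

(** The three colours are the nonzero elements of the group (Z/2)^2, where a sum
    is zero when the three numbers of terms have the same parity.  So this weight
    counts nowhere-zero flows in a group of order 4.  As 2 is a square root of -1,
    the powers of 2 give a sign to each edge. *)
Definition parity_weight (a : counts) : F5 :=
  let: (i, j, k) := a in
  - 2 ^+ (i + j + k) * ((odd i == odd j) && (odd j == odd k))%:R.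


Lemma countsD i j k i' j' k' :
  ((i, j, k) : counts) + (i', j', k') = (i + i', j + j', k + k')%N.
Proof. by []. Qed.

Lemma five0 : 5%:R = 0 :> F5. Proof. exact/val_inj. Qed.

Lemma parity_link a b :
  \sum_c parity_weight (a + count_color c) * parity_weight (b + count_color c) =
  parity_weight (a + b) + parity_weight a * parity_weight b.
Proof.
case: a b => [[i j] k] [[i' j'] k'].
rewrite sum_color !countsD /parity_weight.
rewrite !addn0 !addn1 !oddD !oddS !exprD !exprS.
set u := 2 ^+ i; set v := 2 ^+ j; set w := 2 ^+ k.
set u' := 2 ^+ i'; set v' := 2 ^+ j'; set w' := 2 ^+ k'.
move: (odd i) (odd j) (odd k) (odd i') (odd j') (odd k').
have: 2 * 2 = -1 :> F5 by exact/val_inj.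
move: {u v w u' v' w'} (u) (v) (w) (u') (v') (w') (2 : F5) => u v w u' v' w' z zz.
by do 6 case => /=; ring: zz.
Qed.

Lemma parity_loop a :
  \sum_c parity_weight (a + count_color c + count_color c) = (1 - 4) * parity_weight a.
Proof.
case: a => [[i j] k].
rewrite sum_color /count_color !(countsD i j k) !countsD /parity_weight.
rewrite !addn0 !addn1 !oddS !negbK !exprD !exprS.
set u := 2 ^+ i; set v := 2 ^+ j; set w := 2 ^+ k; set s := (_ && _)%:R.
have -> : 1 - 4 = 2 :> F5 by exact/val_inj.
have: 2 * 2 = -1 :> F5 by exact/val_inj.
have: 3 = -2 :> F5 by exact/val_inj.
move: {u v w} (u) (v) (w) (2 : F5) => u v w z e3 zz.
transitivity (3 * (- (z * z * (u * v * w)) * s)); first by ring.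
by rewrite e3 zz; ring.
Qed.

Lemma parity0 : parity_weight 0 = -1.
Proof. by rewrite /parity_weight /= mulr1. Qed.

Definition spin : finType := option color.
Definition spin_counts : nmodType := (nat * counts)%type.
Definition count_spin (l : spin) : spin_counts :=
  if l is Some c then (0%N, count_color c) else (1%N, 0).

(** The trace, on products of labels, of the Frobenius algebra spanned by 1, by
    vectors e_1, e_2, e_3 and by w, where e_i e_j is w if i = j and 0 otherwise,
    w e_i = w^2 = 0, the scalar label is 1 + w and the trace takes the values -1
    on 1, 1 on w and 0 on the vectors. *)
Definition spin_weight (a : spin_counts) : F5 :=
  let: (n, (i, j, k)) := a in
  let z i := (i == 0%N)%:R : F5 in let d i := (i == 2)%:R : F5 in
  (n%:R - 1) * (z i * z j * z k) +
  (d i * z j * z k + z i * d j * z k + z i * z j * d k).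

Lemma sum_spin (R : nmodType) (F : spin -> R) :
  \sum_c F c = F None + (F (Some None) + F (Some (Some true)) + F (Some (Some false))).
Proof. by rewrite big_option sum_color. Qed.

Lemma spin_countsD n (i j k : nat) n' i' j' k' :
  ((n, (i, j, k)) : spin_counts) + (n', (i', j', k')) =
  (n + n', (i + i', j + j', k + k'))%N.
Proof. by []. Qed.

Lemma spin_link a b :
  \sum_l spin_weight (a + count_spin l) * spin_weight (b + count_spin l) =
  spin_weight (a + b) + spin_weight a * spin_weight b.
Proof.
case: a b => [n [[i j] k]] [n' [[i' j'] k']].
rewrite sum_spin !spin_countsD /spin_weight !addn0 !addn1 !natrD -!natr1.
have z0 m : (m.+1 == 0%N)%:R = 0 :> F5 by [].
have d1 m : (m.+1 == 2)%:R = (m == 1%N)%:R :> F5 by [].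
have zD m m' : (m + m' == 0)%N%:R = (m == 0%N)%:R * (m' == 0%N)%:R :> F5.
  by rewrite addn_eq0 -mulnb natrM.
have dD m m' : (m + m' == 2)%N%:R = (m == 2)%:R * (m' == 0%N)%:R +
    (m == 1%N)%:R * (m' == 1%N)%:R + (m == 0%N)%:R * (m' == 2)%:R :> F5.
  case: m m' => [|[|[|m]]] [|[|[|m']]];
    by rewrite //= ?addnS /= ?(mulr0, mul0r, mulr1, addr0, add0r).
rewrite !z0 !d1 !zD !dD.
ring.
Qed.

(** In the algebra above, the squares of the labels add up to 1 + (2 + n) w for
    n vectors, hence to 1 for n = 3. *)
Lemma spin_loop a :
  \sum_l spin_weight (a + count_spin l + count_spin l) = (1 - 0) * spin_weight a.
Proof.
case: a => [n [[i j] k]].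
rewrite sum_spin /count_spin /count_color !(spin_countsD n i j k) !spin_countsD.
rewrite /spin_weight !addn0 !addn1 -[n.+2%:R]natr1 -natr1 !eqSS.
have z0 m : (m.+2 == 0%N)%:R = 0 :> F5 by [].
rewrite !z0 subr0 mul1r.
set zi := (i == 0%N)%:R; set zj := (j == 0%N)%:R; set zk := (k == 0%N)%:R.
apply/eqP; rewrite -subr_eq0 -[X in _ == X](mul0r (zi * zj * zk)); apply/eqP.
transitivity (5%:R * (zi * zj * zk)); last by rewrite five0.
ring.
Qed.

Lemma spin0 : spin_weight 0 = -1.
Proof. exact/val_inj. Qed.

(** * Flow polynomials as label networks *)

Section FlowNetwork.
Variables (R : comNzRingType) (M : nmodType) (L : finType) (x : L -> M).
Variables (t : M -> R) (q : int).
Hypothesis t_link : forall a b,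
  \sum_l t (a + x l) * t (b + x l) = t (a + b) + t a * t b.
Hypothesis t_loop : forall a, \sum_l t (a + x l + x l) = (1 - q%:~R) * t a.
Hypothesis t0 : t 0 = -1.
Variables (G : graph) (m : ghalf G -> ghalf G) (hm : is_matching m).
Hypothesis edgesE : gedges G = [set [set h; m h] | h : ghalf G].

Let e0 : rel (gvertex G) := [rel u v | u == v].
Let ends := edge_ends (@gbase G) (m := m).
Let set_of (i : edge m) : {set ghalf G} := [set val i; m (val i)].

Let e0_connect u v : connect e0 u v = (u == v).
Proof.
apply/idP/eqP => [|->]; last exact: connect0.
case/connectP=> p; elim: p u => [|w p IH] u //= /andP[/eqP -> pth]; exact: IH.
Qed.

Let e0_sym : connect_sym e0.
Proof. by move=> u v; rewrite !e0_connect eq_sym. Qed.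

Lemma set_of_edge_of h : set_of (edge_of hm h) = [set h; m h].
Proof.
rewrite /set_of val_edge_of; case: ifP => // _.
by rewrite (matching_invol hm) setUC.
Qed.

Lemma set_of_inj : injective set_of.
Proof.
move=> i j /setP/(_ (val i)); rewrite !inE eqxx /= => /esym.
by rewrite -(edge_of_eq hm) edge_of_val => /eqP.
Qed.

Lemma gedges_set_of : gedges G = set_of @: setT.
Proof.
rewrite edgesE; apply/setP=> e; apply/imsetP/imsetP => [[h _ ->]|[i _ ->]].
  by exists (edge_of hm h); rewrite ?set_of_edge_of.
by exists (val i).
Qed.

Lemma card_gedges : #|gedges G| = #|{: edge m}|.
Proof. by rewrite gedges_set_of card_imset ?cardsT //; apply: set_of_inj. Qed.

Lemma sum_subsets_gedges (F : {set {set ghalf G}} -> R) :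
  \sum_(B : {set {set ghalf G}} | B \subset gedges G) F B =
  \sum_(A : {set edge m}) F (set_of @: A).
Proof.
rewrite (reindex_onto (fun A : {set edge m} => set_of @: A)
  (fun B => set_of @^-1: B)) /=.
  apply: eq_bigl => A; rewrite gedges_set_of imsetS ?subsetT //=.
  apply/eqP/setP=> i; rewrite inE mem_imset //; exact: set_of_inj.
move=> B; rewrite gedges_set_of => /subsetP BE; apply/setP=> e.
apply/imsetP/idP => [[i]|eB]; first by rewrite inE => ? ->.
by have /imsetP[i _ ei] := BE e eB; exists i; rewrite // inE -ei.
Qed.

Lemma adjacent_edge_rel (A : {set edge m}) :
  connect (adjacent (set_of @: A)) =2 connect (edge_rel e0 ends A).
Proof.
move=> u v; apply/idP/idP; apply: connect_sub => {}u {}v.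
  case/existsP=> e /andP[/imsetP[i iA ->]] /andP[].
  have ab : connect (edge_rel e0 ends A) (gbase (val i)) (gbase (m (val i))).
    apply: connect1; apply/orP; right; apply/existsP; exists i.
    by rewrite iA eqxx.
  have ba : connect (edge_rel e0 ends A) (gbase (m (val i))) (gbase (val i)).
    by rewrite edge_rel_sym.
  case/imsetP=> h; rewrite !inE => /orP[]/eqP-> ->;
  case/imsetP=> h'; rewrite !inE => /orP[]/eqP-> -> //; exact: connect0.
case/orP=> [/eqP -> //|/existsP[i /andP[iA pi]]].
apply: connect1; apply/existsP; exists (set_of i); rewrite imset_f //=.
have ha : gbase (val i) \in @gbase G @: set_of i.
  by apply: imset_f; rewrite !inE eqxx.
have hb : gbase (m (val i)) \in @gbase G @: set_of i.
  by apply: imset_f; rewrite !inE eqxx orbT.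
by case/orP: pi => /eqP[<- <-]; apply/andP.
Qed.

Lemma ncomponents_edge_rel (A : {set edge m}) :
  ncomponents (set_of @: A) = #|components (edge_rel e0 ends A)|.
Proof.
rewrite -(eq_components (adjacent_edge_rel A)) card_components //.
by move=> u v; rewrite !adjacent_edge_rel edge_rel_sym.
Qed.

Let imset_vertices : [set id u | u in gvertex G] = setT.
Proof. by apply/setP=> u; rewrite inE; apply/imsetP; exists u. Qed.

Lemma card_components_e0 : #|components e0| = #|gvertex G|.
Proof.
have E := @big_components_fibres _ 0%N addn _ e0 _ id (fun=> 1%N) e0_connect.
by rewrite -[LHS]sum1_card E sum1_card imset_vertices cardsT.
Qed.

(** The sign of the set of edges [A] is the same on both sides because its cycle
    rank plus its number of components has the parity of #|A| + #|V|. *)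
Theorem flow_network (l0 : L) :
  ((-1) ^+ (#|gvertex G| + #|gedges G|) * (flow_poly G).[q])%:~R =
  (q%:~R - 1) ^+ gcircles G *
  \sum_(l : {ffun ghalf G -> L} | minv m l)
    \prod_v t (\sum_(h | gbase h == v) x (l h)).
Proof.
rewrite /flow_poly hornerM horner_exp horner_sum.
have -> : ('X - 1 : {poly int}).[q] = q - 1 by rewrite !hornerE.
rewrite mulrCA rmorphM /= rmorphXn rmorphB /= rmorph1; congr (_ * _).
transitivity (\sum_(l : {ffun ghalf G -> L} | minv m l)
    \prod_(C in components e0) t (\sum_(h | gbase h \in C) x (l h))); last first.
  apply: eq_bigr => l _; rewrite (@big_components_fibres _ _ _ _ e0 _ id _ e0_connect).
  rewrite imset_vertices; apply: eq_big => [v|v _]; first by rewrite inE.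
  by congr t; apply: eq_bigl => h; rewrite inE.
rewrite (half_edge_expansion t_link t_loop t0 e0_sym _ hm l0).
rewrite mulr_sumr rmorph_sum sum_subsets_gedges; apply: eq_bigr => A _ /=.
have cA : #|set_of @: A| = #|A| by rewrite card_imset //; apply: set_of_inj.
rewrite hornerZ hornerXn cA ncomponents_edge_rel -/ends.
rewrite /nullity card_components_e0.
have := card_components_edge_rel ends e0_sym A; rewrite card_components_e0.
have := max_card (mem A); rewrite -card_gedges.
set c := #|components _|; set a := #|A|; set E := #|gedges G|; set V := #|gvertex G|.
move=> aE Vc; rewrite mulrA -exprD rmorphM !rmorphXn /= rmorphN1.
rewrite (exprNn q%:~R) [RHS]mulrAC -[in RHS]exprD; congr (_ * _).
rewrite -signr_odd -[RHS]signr_odd; congr (_ ^+ nat_of_bool _).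
by lia.
Qed.

End FlowNetwork.

(** * Strands of a resolved diagram *)

Section Dihedral.
Variables (T : finType) (m s : T -> T).
Hypotheses (hm : is_matching m) (sK : involutive s).

Let e : rel T := [rel x y | (y == m x) || (y == s x)].
Let f x := s (m x).

Let f_inj : injective f.
Proof. by move=> x y /(inv_inj sK) /(matching_inj hm). Qed.

Let iter_s k x : s x = x -> iter k f (s (iter k f x)) = x.
Proof.
move=> sx; elim: k => [|k IH] //=.
by rewrite -iterS iterSr /f sK (matching_invol hm) -/(f _).
Qed.

(** The component of [d] is the cycle of [d] under [f = s m], and on this cycle
    [s] is the reflection that sends the [k]-th iterate to the [-k]-th one.  As
    [m] has no fixed point, the cycle has even length, and the reflection fixes
    exactly one other element, the opposite one. *)
Lemma strand_ends d : s d = d ->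
  exists d', [/\ d' != d, s d' = d', connect e d d' &
    forall y, connect e d y -> s y = y -> y = d \/ y = d'].
Proof.
move=> sd; set N := fingraph.order f d.
have fN : iter N f d = d by exact: iter_order.
have fkI k : injective (iter k f) by elim: k => [|k IH] x y //= /f_inj/IH.
have s_iter k : (k <= N)%N -> s (iter k f d) = iter (N - k) f d.
  move=> kN; apply: (@fkI k); rewrite iter_s // -iterD.
  by rewrite subnKC.
have m_iter k : (k < N)%N -> m (iter k f d) = iter (N - k.+1) f d.
  by move=> kN; rewrite -s_iter //= /f sK.
have inN i j : (i < N)%N -> (j < N)%N -> iter i f d = iter j f d -> i = j.
  by move=> iN jN E; rewrite -(findex_iter iN) E findex_iter.
have N0 : (0 < N)%N by exact: fingraph.order_gt0.
have connN y : connect e d y -> exists2 k, (k < N)%N & y = iter k f d.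
  case/connectP=> p; elim/last_ind: p y => [|p z IH] y /=; first by move=> _ ->; exists 0%N.
  rewrite rcons_path last_rcons => /andP[/IH{}IH E] ->.
  have [k kN Ek] := IH _ erefl; rewrite {}Ek in E; case/orP: E => /eqP ->.
    by rewrite m_iter //; exists (N - k.+1)%N => //; lia.
  case: k kN => [|k] kN; first by rewrite /= sd; exists 0%N.
  by rewrite s_iter 1?ltnW //; exists (N - k.+1)%N => //; lia.
have [k kE] : exists k, N = k.*2.
  exists N./2; rewrite -[LHS]odd_double_half; case: (boolP (odd N)) => // oN.
  have EN : N = (N./2).*2.+1 by rewrite -[LHS]odd_double_half oN.
  have kN : (N./2 < N)%N by lia.
  have := matching_neq hm (iter N./2 f d); rewrite m_iter //.
  by rewrite (_ : N - (N./2).+1 = N./2)%N ?eqxx //; lia.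
have kN : (k < N)%N by lia.
exists (iter k f d); split.
- by apply/eqP=> /(inN k 0%N kN N0); lia.
- by rewrite s_iter 1?ltnW //; congr iter; lia.
- elim: (k) => [|j IH] /=; first exact: connect0.
  apply: connect_trans IH _; apply: connect_trans (connect1 _) (connect1 _).
    by apply/orP; left; apply/eqP.
  by apply/orP; right; apply/eqP.
move=> y /connN[[|j] jN ->]; first by left.
rewrite s_iter 1?ltnW // => /inN; rewrite jN => /(_ _ isT) E; right.
by congr (iter _ f d); move: E; lia.
Qed.

End Dihedral.

Section Strands.
Variables (D : diagram) (p : crossing D -> tangle).
Hypothesis hd : is_matching (@darc D : dend D -> dend D).
Hypothesis hp : forall x g, p x = Some g -> is_matching g.

(** Crosses a resolved crossing; its fixed points are the half-edges of the
    resolution. *)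
Definition across (d : dend D) : dend D :=
  match d with
  | inl h => inl h
  | inr (x, i) => if p x is Some g then inr (x, g i) else inr (x, i)
  end.

Lemma acrossK : involutive across.
Proof.
case=> [//|[x i]] /=; case E: (p x) => [g|] /=; rewrite E //.
by rewrite (matching_invol (hp E)).
Qed.

Lemma across_rend h : across (rend h) = rend (p := p) h.
Proof. by case: h => [//|[[x px] i]] /=; case: (p x) px. Qed.

Lemma across_fixed d : across d = d -> exists h : rhalf p, rend h = d.
Proof.
case: d => [h _|[x i]]; first by exists (inl h).
move=> /=; case E: (p x) => [g|] => [[gi]|_].
  by have := matching_neq (hp E) i; rewrite gi eqxx.
have px : ~~ isSome (p x) by rewrite E.
by exists (inr (exist (fun x => ~~ isSome (p x)) x px, i)).
Qed.

Lemma rend_inj : injective (@rend D p).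
Proof.
case=> [h|[x i]] [h'|[x' i']] //=; first by case=> ->.
by case=> /val_inj -> ->.
Qed.

Let e : rel (dend D) := [rel x y | (y == darc x) || (y == across x)].

Lemma connect_joined : connect (joined p) =2 connect e.
Proof.
move=> u v; apply/idP/idP; apply: connect_sub => {}u {}v /orP[uv|uv].
- by apply: connect1; rewrite /e /= uv.
- apply: connect1; case: u uv => // -[x i]; rewrite /e /=.
  by case: (p x) => // g ->; rewrite orbT.
- by apply: connect1; apply/orP; left.
case: u uv => [h /eqP ->|[x i]] /=; first exact: connect0.
case E: (p x) => [g|] /eqP->; last exact: connect0.
by apply: connect1; apply/orP; right; rewrite E.
Qed.

Lemma joined_sym : connect_sym (joined p).
Proof.
move=> u v; rewrite !connect_joined; apply: sym_connect_sym => {}u {}v.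
by rewrite /e /= !(eq_sym u) (can2_eq (matching_invol hd) (matching_invol hd))
  (can2_eq acrossK acrossK) (eq_sym v) (eq_sym v (across u)).
Qed.

Lemma strand_mate_ex (h : rhalf p) : exists h' : rhalf p,
  [/\ h' != h, connect (joined p) (rend h) (rend h') &
   forall k : rhalf p, connect (joined p) (rend h) (rend k) -> k = h \/ k = h'].
Proof.
have [d' [ne sd hd' uniq_d']] := strand_ends hd acrossK (across_rend h).
have [h' Eh'] := across_fixed sd; exists h'; split.
- by apply: contra ne => /eqP <-; rewrite Eh'.
- by rewrite connect_joined Eh'.
move=> k; rewrite connect_joined => /uniq_d'/(_ (across_rend k)) [/rend_inj->|].
  by left.
by rewrite -Eh' => /rend_inj ->; right.
Qed.

Definition strand_mate (h : rhalf p) : rhalf p :=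
  odflt h [pick h' | (h' != h) && connect (joined p) (rend h) (rend h')].

Lemma strand_mateP h : strand_mate h != h /\
  forall k, connect (joined p) (rend h) (rend k) = (k == h) || (k == strand_mate h).
Proof.
have [h' [ne hh' un]] := strand_mate_ex h.
have -> : strand_mate h = h'.
  rewrite /strand_mate; case: pickP => [k /andP[kh /un[E|//]]|/(_ h')].
    by rewrite E eqxx in kh.
  by rewrite ne hh'.
split=> // k; apply/idP/orP => [/un[]->|[/eqP->|/eqP->] //].
  by left.
by right.
Qed.

Lemma strand_mate_matching : is_matching strand_mate.
Proof.
split=> h; last by case: (strand_mateP h).
have [ne1 E1] := strand_mateP h; have [ne2 E2] := strand_mateP (strand_mate h).
have := E2 h; rewrite joined_sym E1 eqxx orbT eq_sym (negPf ne1) /=.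
by move/esym/eqP.
Qed.

Lemma gedges_resolve :
  gedges (resolve p) = [set [set h; strand_mate h] | h : rhalf p].
Proof.
have E h : strand_halves p (component (joined p) (rend h)) = [set h; strand_mate h].
  by apply/setP=> k; rewrite !inE; case: (strand_mateP h) => _ ->.
apply/setP=> S; rewrite !inE; apply/andP/imsetP => [[S0 /imsetP[C]]|[h _ ->]].
  case/imsetP=> d _ -> ES; case/set0Pn: S0 => h; rewrite ES !inE => dh.
  exists h => //; rewrite -E; congr (strand_halves p); apply/setP=> d'.
  by rewrite !inE (same_connect joined_sym dh).
split; first by apply/set0Pn; exists h; rewrite !inE eqxx.
by apply/imsetP; exists (component (joined p) (rend h)); rewrite ?E ?mem_components.
Qed.

Section Labels.
Variables (L : finType) (l0 : L).

Definition strand_invariant (l : {ffun dend D -> L}) : bool :=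
  minv (@darc D) l && minv across l.

Lemma strand_invariantP l d d' : strand_invariant l ->
  connect (joined p) d d' -> l d' = l d.
Proof.
case/andP=> /minvP md /minvP ma; rewrite connect_joined => /connectP[q].
elim: q d => [|y q IH] d /=; first by move=> _ ->.
by case/andP=> /orP[]/eqP -> pth /(IH _ pth) ->.
Qed.

Let circle : finType :=
  {S : {set dend D} | (S \in strands p) && (strand_halves p S == set0)}.

Let circle_set (c : circle) : {set dend D} := val c.

(** The value [l0] is only a default: an end whose strand has no half-edge lies
    on a circle. *)
Let extend (lg : {ffun rhalf p -> L} * {ffun circle -> L}) : {ffun dend D -> L} :=
  [ffun d => if [pick h | connect (joined p) d (rend h)] is Some h then lg.1 h else
     if insub (component (joined p) d) is Some c then lg.2 c else l0].

Let restrict (l : {ffun dend D -> L}) :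
    {ffun rhalf p -> L} * {ffun circle -> L} :=
  ([ffun h => l (rend h)],
   [ffun c : circle => if [pick d in circle_set c] is Some d then l d else l0]).

Let extend_invariant lg : strand_invariant (extend lg).
Proof.
have E d d' : connect (joined p) d d' -> extend lg d' = extend lg d.
  move=> dd'; rewrite !ffunE.
  rewrite (eq_pick (fun h => esym (same_connect joined_sym dd' (rend h)))).
  case: pickP => // _; congr (if insub _ is Some c then _ else _).
  by apply/eqP; rewrite (eq_component _ _ joined_sym) joined_sym.
apply/andP; split; apply/minvP=> d; apply: E; rewrite connect_joined;
  by apply: connect1; rewrite /e /= eqxx ?orbT.
Qed.

Let extend_rend lg h : minv strand_mate lg.1 -> extend lg (rend h) = lg.1 h.
Proof.
move=> /minvP mlg; rewrite ffunE; case: pickP => [k|/(_ h)]; last by rewrite connect0.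
by case: (strand_mateP h) => _ -> /orP[]/eqP-> //.
Qed.

Let circle_nonempty c : exists2 d, d \in circle_set c & circle_set c = component (joined p) d.
Proof.
case/andP: (valP c) => /imsetP[d _ E] _; exists d => //.
by rewrite /circle_set E inE connect0.
Qed.

Let circle_no_half c d (h : rhalf p) : d \in circle_set c -> connect (joined p) d (rend h) = false.
Proof.
case/andP: (valP c) => /imsetP[d0 _ E] /eqP/setP/(_ h).
rewrite inE [in rend h \in _]E !inE /circle_set E inE => nh dd.
by rewrite -(same_connect joined_sym dd).
Qed.

Let extendK l : strand_invariant l -> extend (restrict l) = l.
Proof.
move=> inv; apply/ffunP=> d; rewrite ffunE.
case: pickP => [h dh|noh]; first by rewrite ffunE (strand_invariantP inv dh).
case: insubP => [c _ Ec|].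
  rewrite ffunE; case: pickP => [d' |/(_ d)]; rewrite /circle_set Ec inE ?connect0 //.
  by move/(strand_invariantP inv).
case/negP; apply/andP; split; first exact: mem_components.
by apply/eqP/setP=> h; rewrite !inE noh.
Qed.

Let restrictK lg : (restrict (extend lg) == lg) = minv strand_mate lg.1.
Proof.
apply/eqP/idP => [E|mlg].
  have E1 h : lg.1 h = extend lg (rend h) by rewrite -{1}E ffunE.
  apply/minvP=> h; rewrite !E1; apply: (strand_invariantP (extend_invariant lg)).
  by case: (strand_mateP h) => _ ->; rewrite eqxx orbT.
case: lg mlg => l g mlg; rewrite /restrict /=.
have -> : [ffun h => extend (l, g) (rend h)] = l.
  by apply/ffunP=> h; rewrite ffunE extend_rend.
congr pair; apply/ffunP=> c; rewrite ffunE.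
case: pickP => [d dc|noc].
  rewrite ffunE; case: pickP => [h|_]; first by rewrite (circle_no_half _ dc).
  have [d' _ Ec] := circle_nonempty c.
  have <- : circle_set c = component (joined p) d.
    apply/eqP; rewrite Ec (eq_component _ _ joined_sym).
    by move: dc; rewrite Ec inE.
  by rewrite valK.
by have [d dc _] := circle_nonempty c; have := noc d; rewrite dc.
Qed.

(** A strand without half-edges has closed up into a circle, and its label is
    free. *)
Lemma sum_strand_labels (R : nmodType) (G : {ffun rhalf p -> L} -> R) :
  \sum_(l | strand_invariant l) G [ffun h => l (rend h)] =
  (\sum_(l | minv strand_mate l) G l) *+
    (#|L| ^ #|[set S in strands p | strand_halves p S == set0]|).
Proof.
rewrite (reindex_onto extend restrict extendK) /=.
transitivity (\sum_(lg : {ffun rhalf p -> L} * {ffun circle -> L} |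
    minv strand_mate lg.1 && true) G lg.1).
  apply: eq_big => [lg|lg]; first by rewrite extend_invariant restrictK andbT.
  rewrite restrictK => /andP[_ mlg]; congr G; apply/ffunP=> h.
  by rewrite ffunE extend_rend.
rewrite -(pair_big (fun l : {ffun rhalf p -> L} => minv strand_mate l) predT (fun l _ => G l)) -sumrMnl /=.
apply: eq_bigr => l _; rewrite sumr_const card_ffun card_sig; congr (_ *+ (_ ^ _)).
by rewrite cardsE.
Qed.

End Labels.
End Strands.

(** * The Yamada polynomial as a label network *)

Definition o0 : 'I_4 := @Ordinal 4 0 isT.
Definition o1 : 'I_4 := @Ordinal 4 1 isT.
Definition o2 : 'I_4 := @Ordinal 4 2 isT.
Definition o3 : 'I_4 := @Ordinal 4 3 isT.

Lemma ord4_ind (P : 'I_4 -> Prop) : P o0 -> P o1 -> P o2 -> P o3 -> forall i, P i.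
Proof.
move=> P0 P1 P2 P3 [[|[|[|[|k]]]] ik] //.
- by rewrite (_ : Ordinal _ = o0) //; apply: val_inj.
- by rewrite (_ : Ordinal _ = o1) //; apply: val_inj.
- by rewrite (_ : Ordinal _ = o2) //; apply: val_inj.
- by rewrite (_ : Ordinal _ = o3) //; apply: val_inj.
Qed.

Lemma big_ord4 R (idx : R) (op : Monoid.law idx) (F : 'I_4 -> R) :
  \big[op/idx]_i F i = op (F o0) (op (F o1) (op (F o2) (F o3))).
Proof.
rewrite !big_ord_recl big_ord0 Monoid.mulm1.
by congr (op (F _) (op (F _) (op (F _) (F _)))); apply: val_inj.
Qed.

Lemma smooth0E :
  (smooth0 o0 = o1) * (smooth0 o1 = o0) * (smooth0 o2 = o3) * (smooth0 o3 = o2).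
Proof. by do !split; apply: val_inj. Qed.

Lemma smooth1E :
  (smooth1 o0 = o3) * (smooth1 o1 = o2) * (smooth1 o2 = o1) * (smooth1 o3 = o0).
Proof. by do !split; apply: val_inj. Qed.

Lemma smooth0_matching : is_matching smooth0.
Proof. by split; elim/ord4_ind; rewrite ?smooth0E. Qed.

Lemma smooth1_matching : is_matching smooth1.
Proof. by split; elim/ord4_ind; rewrite ?smooth1E. Qed.

Definition smoothing (o : option bool) : tangle :=
  omap (fun b : bool => if b then smooth1 else smooth0) o.

Lemma smoothing_matching o g : smoothing o = Some g -> is_matching g.
Proof.
by case: o => [[]|] //= [<-]; [apply: smooth1_matching|apply: smooth0_matching].
Qed.

Lemma signr_exprz (V E : nat) : (-1 : int) ^ (V%:Z - E%:Z) = (-1) ^+ (V + E).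
Proof.
rewrite exprzDr ?unitrN1 // exprD; congr (_ * _).
by rewrite -invr_expz -exprnP invr_sign.
Qed.

Lemma planar_yamada_int (H : graph) (q : int) :
  planar_yamada H q =
  (-1) ^+ (#|gvertex H| + #|gedges H|) * (flow_poly H).[q + 2 + q^-1].
Proof.
rewrite /planar_yamada signr_exprz map_poly_id // => c _; exact: intz.
Qed.

Section YamadaNetwork.
Variables (R : comNzRingType) (M : nmodType) (L : finType) (x : L -> M) (l0 : L).
Variables (t : M -> R) (q : int).
Let Q : int := q + 2 + q^-1.
Hypothesis t_link : forall a b,
  \sum_l t (a + x l) * t (b + x l) = t (a + b) + t a * t b.
Hypothesis t_loop : forall a, \sum_l t (a + x l + x l) = (1 - Q%:~R) * t a.
Hypothesis t0 : t 0 = -1.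
Hypothesis card_L : #|L|%:R = Q%:~R - 1 :> R.
Variables (D : diagram).
Hypothesis hd : is_matching (@darc D : dend D -> dend D).

Definition local_state (o : option bool) (a b c d : L) : R :=
  match o with
  | None => t (x a + x b + x c + x d)
  | Some false => ((a == b) && (c == d))%:R
  | Some true => ((b == c) && (d == a))%:R
  end.

Definition at_crossing T (F : L -> L -> L -> L -> T) (l : {ffun dend D -> L}) y : T :=
  F (l (inr (y, o0))) (l (inr (y, o1))) (l (inr (y, o2))) (l (inr (y, o3))).

Definition at_vertices (l : {ffun dend D -> L}) : R :=
  \prod_(v : dvertex D) t (\sum_(h | dbase h == v) x (l (inl h))).

Let across_smoothing (s : state D) (l : {ffun dend D -> L}) :
  minv (across (fun y => smoothing (s y))) l =
  [forall y, if s y is Some b then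
     (if b then at_crossing (fun a b c d => (b == c) && (d == a)) l y
      else at_crossing (fun a b c d => (a == b) && (c == d)) l y) else true].
Proof.
apply/minvP/forallP => [H y|H [//|[y i]]] /=.
  have Hi i := H (inr (y, i)); case E: (s y) => [[]|] //; rewrite /at_crossing.
    have := Hi o1; have := Hi o3; rewrite /= E /= !smooth1E => -> ->.
    by rewrite !eqxx.
  have := Hi o0; have := Hi o2; rewrite /= E /= !smooth0E => -> ->.
  by rewrite !eqxx.
have := H y; case: (s y) => [[]|] //=; rewrite /at_crossing => /andP[/eqP E1 /eqP E2].
  by elim/ord4_ind: i; rewrite !smooth1E.
by elim/ord4_ind: i; rewrite !smooth0E.
Qed.

(** Labels of the strands are labels of the ends that agree along the arcs and
    across the smoothed crossings. *)
Lemma state_network (s : state D) :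
  (planar_yamada (state_graph s) q)%:~R = #|L|%:R ^+ dcircles D *
    \sum_(l | minv (@darc D) l)
      at_vertices l * \prod_y at_crossing (local_state (s y)) l y.
Proof.
set p := fun y => smoothing (s y).
have hp y g : p y = Some g -> is_matching g by exact: smoothing_matching.
rewrite planar_yamada_int.
rewrite (flow_network (G := resolve p) t_link t_loop t0 (strand_mate_matching hd hp)
  (gedges_resolve hd hp) l0) -card_L exprD -mulrA; congr (_ * _).
rewrite -natrX mulr_natl.
have := sum_strand_labels hd hp l0 (fun l : {ffun rhalf p -> L} =>
  \prod_(v : rvertex p) t (\sum_(h | rbase h == v) x (l h))).
move=> <-; rewrite /strand_invariant big_mkcondr; apply: eq_bigr => l _.
rewrite big_sumType /=.
transitivity (if minv (across p) l then
    at_vertices l * \prod_(y | ~~ isSome (p y)) t (\sum_i x (l (inr (y, i)))) else 0).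
  case: ifP => // _; congr (_ * _).
    apply: eq_bigr => v _; congr t; rewrite big_sumType /= [X in _ + X]big1 ?addr0.
      by apply: eq_bigr => h _; rewrite ffunE.
    by case.
  rewrite (big_sub (fun y => ~~ isSome (p y))) /=; apply: eq_bigr => -[y py] _.
  congr t; rewrite big_sumType /= [X in X + _]big1 ?add0r //.
  rewrite (reindex_onto (fun i => (exist _ y py, i)) snd) /=; last first.
    by case=> y' i /eqP[->].
  by apply: eq_big => [i|i _]; rewrite ?eqxx ?ffunE.
rewrite across_smoothing; case: ifP => [/forallP H|/negbT].
  congr (_ * _); rewrite big_mkcond; apply: eq_bigr => y _.
  have := H y; rewrite /p /at_crossing; case: (s y) => [[]|] /= => [->|->|_] //.
  by rewrite big_ord4 /= !addrA.
rewrite negb_forall => /existsP[y Hy]; rewrite (bigD1 y) //=.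
rewrite (_ : at_crossing _ _ _ = 0) ?mul0r ?mulr0 //.
by move: Hy; rewrite /at_crossing; case: (s y) => [[]|] //= /negPf ->.
Qed.

Definition local_yamada (a b c d : L) : R :=
  t (x a + x b + x c + x d) +
  q%:~R * (((a == b) && (c == d))%:R + ((b == c) && (d == a))%:R).

Lemma state_weight (s : state D) : q = 1 \/ q = -1 ->
  (q ^ state_degree s)%:~R = \prod_y (if isSome (s y) then q%:~R else 1) :> R.
Proof.
move=> hq; rewrite -big_mkcond /= prodr_const.
have -> : #|[pred y | s y]| =
   (#|[set y | s y == Some false]| + #|[set y | s y == Some true]|)%N.
  rewrite -cardsUI (_ : _ :&: _ = set0) ?cards0 ?addn0; last first.
    by apply/setP=> y; rewrite !inE; case: (s y) => [[]|].
  by apply: eq_card => y; rewrite !inE; case: (s y) => [[]|].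
rewrite /state_degree; case: hq => ->; first by rewrite expr1n exp1rz.
by rewrite signr_exprz rmorphXn /= rmorphN1.
Qed.

(** Since [q] is its own inverse, the weight of a state is a product over the
    crossings, and the sum over the states factors. *)
Lemma yamada_network : q = 1 \/ q = -1 ->
  (yamada D q)%:~R = #|L|%:R ^+ dcircles D *
    \sum_(l | minv (@darc D) l) at_vertices l * \prod_y at_crossing local_yamada l y.
Proof.
move=> hq; rewrite /yamada rmorph_sum /=.
under eq_bigr => s _ do rewrite rmorphM /= state_network state_weight // mulrCA mulr_sumr.
rewrite -mulr_sumr exchange_big /=; congr (_ * _); apply: eq_bigr => l _.
under eq_bigr => s _ do rewrite mulrCA -big_split /=.
rewrite -mulr_sumr; congr (_ * _).
rewrite -(bigA_distr_bigA (fun y o => (if isSome o then q%:~R else 1) *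
  at_crossing (local_state o) l y)).
apply: eq_bigr => y _; rewrite big_option big_bool /= /at_crossing /local_yamada /=.
by rewrite mul1r mulrDr [X in _ + X]addrC.
Qed.

End YamadaNetwork.

(** * Euler's formula *)

Section Euler.
Variable T : finType.
Implicit Types r m s : {perm T}.

Definition orbits s : nat := #|porbits s|.

Lemma fconnect_porbit s x y : fconnect s x y = (y \in porbit s x).
Proof.
apply/idP/porbitP => [/iter_findex <-|[i ->]].
  by exists (findex s x y); rewrite permX.
by rewrite permX; apply: fconnect_iter.
Qed.

Lemma porbits_components s : porbits s = components (frel s).
Proof.
apply: eq_imset => x; apply/setP=> y; by rewrite inE fconnect_porbit.
Qed.

Lemma perm_connect_sym s : connect_sym (frel s).
Proof. exact/fconnect_sym/perm_inj. Qed.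

Lemma fcard_orbits s : fcard s predT = orbits s.
Proof. by rewrite /orbits porbits_components card_components //; apply: perm_connect_sym. Qed.

Definition map_rel r m : rel T := [rel x y | (y == r x) || (y == m x)].

Lemma fconnect_map_rel r m x y : fconnect r x y -> connect (map_rel r m) x y.
Proof.
apply: connect_sub => {}x {}y /eqP <-; apply: connect1; by rewrite /map_rel /= eqxx.
Qed.

Lemma map_relC r m : map_rel r m =2 map_rel m r.
Proof. by move=> x y; rewrite /map_rel /= orbC. Qed.

Lemma map_rel_sym r m : connect_sym (map_rel r m).
Proof.
have rev x y : map_rel r m x y -> connect (map_rel r m) y x.
  case/orP=> /eqP ->.
    by apply: fconnect_map_rel; rewrite perm_connect_sym fconnect1.
  rewrite (eq_connect (map_relC r m)); apply: fconnect_map_rel.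
  by rewrite perm_connect_sym fconnect1.
have one x y : connect (map_rel r m) x y -> connect (map_rel r m) y x.
  case/connectP=> p; elim: p x => [|z p IH] x /=; first by move=> _ ->.
  by case/andP=> xz pth /(IH _ pth) zy; apply: connect_trans zy (rev _ _ xz).
by move=> x y; apply/idP/idP; apply: one.
Qed.

Definition map_components r m : nat := #|components (map_rel r m)|.

Lemma map_componentsC r m : map_components r m = map_components m r.
Proof. by congr #|pred_of_set _|; apply/eq_components/eq_connect/map_relC. Qed.

Lemma orbits_mulC r m : orbits (r * m) = orbits (m * r).
Proof.
have comm i x : ((m * r) ^+ i)%g (r x) = r (((r * m) ^+ i)%g x).
  elim: i x => [|i IH] x; first by rewrite !expg0 !perm1.
  by rewrite !expgS !permM -IH.
rewrite /orbits (_ : porbits (m * r) = (fun C : {set T} => r @: C) @: porbits (r * m)).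
  by rewrite card_imset //; apply/imset_inj/perm_inj.
have img x : porbit (m * r) (r x) = r @: porbit (r * m) x.
  apply/setP=> y; apply/porbitP/imsetP => [[i ->]|[z /porbitP[i ->] ->]].
    by exists (((r * m) ^+ i)%g x); rewrite ?comm // mem_porbit.
  by exists i; rewrite comm.
apply/setP=> C; apply/imsetP/imsetP => [[x _ ->]|[C' /imsetP[x _ ->] ->]].
  exists (porbit (r * m) (r^-1%g x)); first exact: imset_f.
  by rewrite -img permKV.
by exists (r x).
Qed.

Lemma connect_split r m x y : y \in porbit r x ->
  connect (map_rel r m) =2 connect (add_edge (map_rel (tperm x y * r) m) x y).
Proof.
move=> xy u v; set r' := (tperm x y * r)%g.
have r'E w : r' w = r (tperm x y w) by rewrite permM.
have conn_xy : connect (map_rel r m) x y.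
  by apply: fconnect_map_rel; rewrite fconnect_porbit.
have conn_yx : connect (map_rel r m) y x by rewrite map_rel_sym.
have exy : connect (add_edge (map_rel r' m) x y) x y.
  by apply: connect1; rewrite /add_edge /= !eqxx orbT.
have eyx : connect (add_edge (map_rel r' m) x y) y x.
  by apply: connect1; rewrite /add_edge /= !eqxx !orbT.
apply/idP/idP; apply: connect_sub => {u v} u v.
  case/orP=> /eqP ->; last first.
    by apply: connect1; rewrite /add_edge /map_rel /= eqxx orbT.
  have e1 w : connect (add_edge (map_rel r' m) x y) w (r' w).
    by apply: connect1; rewrite /add_edge /map_rel /= eqxx.
  have [->|ux] := eqVneq u x.
    by have := connect_trans exy (e1 y); rewrite r'E tpermR.
  have [->|uy] := eqVneq u y.
    by have := connect_trans eyx (e1 x); rewrite r'E tpermL.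
  by have := e1 u; rewrite r'E tpermD // eq_sym.
case/or3P=> [/orP[]/eqP->|/andP[/eqP-> /eqP->] //|/andP[/eqP-> /eqP->] //].
  have e1 w : connect (map_rel r m) w (r w).
    by apply: connect1; rewrite /map_rel /= eqxx.
  rewrite r'E; case: tpermP => [->|->|_ _] //.
    exact: connect_trans conn_xy (e1 y).
  exact: connect_trans conn_yx (e1 x).
by apply: connect1; rewrite /map_rel /= eqxx orbT.
Qed.

(** Splitting a cycle of the rotation in two does not increase the genus: the
    number of faces changes by 1, and it increases if the split disconnects the
    map, since [x] and [y] then lie on distinct faces afterwards. *)
Lemma split_genus r m x y : x != y -> y \in porbit r x ->
  let r' : {perm T} := (tperm x y * r)%g in
  orbits r' = (orbits r).+1 /\
  (2 * map_components r' m + (orbits r + orbits (r * m)) <=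
   2 * map_components r m + (orbits r' + orbits (r' * m)))%N.
Proof.
move=> nxy xy r'.
have A : orbits r' = (orbits r).+1.
  have := porbits_mul_tperm r x y.
  by rewrite /= porbit_sym xy nxy /= addn0 addn1.
split=> //.
have B : (orbits (r' * m) + (x \notin porbit (r * m) y).*2 = (orbits (r * m)).+1)%N.
  by have := porbits_mul_tperm (r * m) x y; rewrite /= nxy addn1 mulgA.
have B' : (orbits (r * m) + (x \notin porbit (r' * m) y).*2 = (orbits (r' * m)).+1)%N.
  have := porbits_mul_tperm (r' * m) x y; rewrite /= nxy addn1 /r' !mulgA.
  by rewrite tperm2 mul1g.
have C : map_components r' m =
    (map_components r m + ~~ connect (map_rel r' m) x y)%N.
  rewrite /map_components (eq_components (connect_split m xy)).
  exact: card_components_add_edge (map_rel_sym _ _).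
rewrite C A; case: (boolP (connect _ x y)) C => [_ _|nc _] /=.
  by move: B; case: (x \notin porbit (r * m) y) => /= B; lia.
have nor : x \notin porbit (r' * m) y.
  apply: contra nc; rewrite -fconnect_porbit => xy'.
  suff: connect (map_rel r' m) y x by rewrite map_rel_sym.
  move: xy'; apply: connect_sub => u v /eqP <-; rewrite permM.
  apply: connect_trans (connect1 _) (connect1 _); apply/orP.
    by left; apply/eqP.
  by right; apply/eqP.
by rewrite nor /= in B'; lia.
Qed.

Lemma orbits1 : orbits (1 : {perm T}) = #|T|.
Proof.
rewrite /orbits; have -> : porbits (1%g : {perm T}) = [set [set x] | x : T].
  apply: eq_imset => x; apply/setP=> y; rewrite in_set1.
  apply/porbitP/eqP => [[i ->]|->]; first by rewrite expg1n perm1.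
  by exists 0%N; rewrite expg0 perm1.
by rewrite card_imset //; apply: set1_inj.
Qed.

(** Cycles of the rotation can be split until the rotation is the identity; for
    the identity there is equality. *)
Lemma euler_le r m :
  (orbits r + orbits m + orbits (r * m) <= #|T| + 2 * map_components r m)%N.
Proof.
set N := #|T|; have [n] := ubnP (N - orbits r); elim: n r => // n IH r rn.
have [->|/eqP r1] := eqVneq r 1%g.
  have -> : map_components 1 m = orbits m.
    rewrite /orbits porbits_components; congr #|pred_of_set _|.
    apply: eq_components => x y; apply/idP/idP; apply: connect_sub => {}x {}y.
      case/orP=> /eqP ->; first by rewrite perm1 connect0.
      by apply: connect1; rewrite /= eqxx.
    by move/eqP <-; apply: connect1; rewrite /map_rel /= eqxx orbT.
  have -> : orbits 1 = N by exact: orbits1.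
  by rewrite mul1g; lia.
have [x rx] : exists x, r x != x.
  apply/existsP; rewrite -negb_forall; apply/negP=> /'forall_eqP H; apply: r1.
  by apply/permP=> x; rewrite H perm1.
have xr : r x \in porbit r x by rewrite -fconnect_porbit fconnect1.
have := split_genus m (_ : x != r x) xr; rewrite eq_sym => /(_ rx) /=.
set r' := (tperm _ _ * r)%g => -[E1 E2].
have le : (orbits r' <= N)%N by rewrite /orbits /porbits; apply: leq_imset_card.
rewrite E1 in E2 le; have H : (N - (orbits r).+1 < n)%N by lia.
by have := IH r'; rewrite E1 => /(_ H); lia.
Qed.

Definition spherical r m : Prop :=
  (orbits r + orbits m + orbits (r * m) = #|T| + 2 * map_components r m)%N.

Lemma spherical_split r m x y : x != y -> y \in porbit r x ->
  spherical r m -> spherical (tperm x y * r) m.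
Proof.
move=> nxy xy; rewrite /spherical; have [E1 E2] := split_genus m nxy xy.
have := euler_le (tperm x y * r) m; lia.
Qed.

Lemma sphericalC r m : spherical r m -> spherical m r.
Proof.
rewrite /spherical [orbits (m * r)]orbits_mulC [map_components m r]map_componentsC.
by rewrite [(orbits m + orbits r)%N]addnC.
Qed.

End Euler.

(** * Colourings of spherical maps *)

Lemma prod_bool (R : comNzRingType) (I : finType) (b : I -> bool) :
  \prod_i ((b i)%:R : R) = [forall i, b i]%:R.
Proof.
case: (boolP [forall i, b i]) => [/forallP H|].
  by rewrite big1 // => i _; rewrite H.
rewrite negb_forall => /existsP[i /negPf Hi].
by rewrite (bigD1 i) //= Hi mul0r.
Qed.

Lemma card_invariant (T B : finType) (s : {perm T}) :
  #|[set y : {ffun T -> B} | minv s y]| = (#|B| ^ orbits s)%N.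
Proof.
pose K : finType := {C : {set T} | C \in porbits s}.
have cl_ex d : exists c : K, val c == porbit s d.
  by exists (exist _ (porbit s d) (imset_f _ (erefl true))).
pose cl d := xchoose (cl_ex d).
have clE d : val (cl d) = porbit s d by apply/eqP/(xchooseP (cl_ex d)).
have cl_eq d d' : (cl d == cl d') = (porbit s d == porbit s d').
  by rewrite -val_eqE !clE.
have cl_onto (c : K) : exists d, cl d = c.
  case/imsetP: (valP c) => d _ E; exists d; apply: val_inj; by rewrite clE E.
have -> : orbits s = #|{: K}| by rewrite card_sig.
rewrite -card_ffun -cardsT.
have -> : [set y : {ffun T -> B} | minv s y] =
    (fun f : {ffun K -> B} => [ffun d => f (cl d)]) @: setT.
  apply/setP=> y; rewrite inE; apply/minvP/imsetP => [sy|[f _ ->] d]; last first.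
    by rewrite !ffunE; congr (f _); apply/eqP; rewrite cl_eq eq_porbit_mem
      -fconnect_porbit fconnect1.
  have cst d d' : fconnect s d d' -> y d' = y d.
    case/connectP=> p; elim: p d => [|z p IH] d /=; first by move=> _ ->.
    by case/andP=> /eqP <- pth /(IH _ pth) ->; rewrite sy.
  have ex (c : K) : exists d, cl d == c by have [d <-] := cl_onto c; exists d.
  exists [ffun c => y (xchoose (ex c))] => //; apply/ffunP=> d; rewrite !ffunE.
  apply: cst; have /eqP := xchooseP (ex (cl d)); move: (xchoose _) => d' E.
  by rewrite fconnect_porbit -eq_porbit_mem -cl_eq E.
rewrite card_imset // => f g /ffunP E; apply/ffunP=> c.
by have [d <-] := cl_onto c; have := E d; rewrite !ffunE.
Qed.

Section PartialMatching.
Variables (T : finType) (r m : {perm T}).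
Hypothesis hm : is_matching m.

(** Followed by the rotation, the matching restricted to the edges [A] has as
    its cycles the boundary components of the ribbon surface of [A]. *)
Definition partial_fun (A : {set edge m}) (d : T) : T :=
  if edge_of hm d \in A then m d else d.

Lemma partial_inj A : injective (partial_fun A).
Proof.
apply: inv_inj => d; rewrite /partial_fun.
case: (boolP (edge_of hm d \in A)) => [dA|/negPf -> //].
by rewrite edge_of_m dA (matching_invol hm).
Qed.

Definition partial A : {perm T} := perm (@partial_inj A).

Lemma partialE A d : partial A d = if edge_of hm d \in A then m d else d.
Proof. by rewrite permE. Qed.

Lemma partialT : partial setT = m.
Proof. by apply/permP=> d; rewrite partialE inE. Qed.

Lemma partial_remove (A : {set edge m}) i : i \notin A ->
  partial A = (tperm (val i) (m (val i)) * partial (i |: A))%g.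
Proof.
move=> iA; apply/permP=> d; rewrite permM !partialE.
have out d' : d' != val i -> d' != m (val i) -> edge_of hm d' != i.
  by move=> n1 n2; rewrite edge_of_eq (negPf n1) (negPf n2).
case: tpermP => [->|->|n1 n2].
- by rewrite edge_of_m edge_of_val (negPf iA) setU11 (matching_invol hm).
- by rewrite edge_of_m edge_of_val (negPf iA) setU11.
by rewrite in_setU1 (negPf (out _ _ _)) //; apply/eqP.
Qed.

Lemma mem_porbit_partial (A : {set edge m}) i : i \in A ->
  m (val i) \in porbit (partial A) (val i).
Proof.
move=> iA; rewrite -fconnect_porbit.
by apply: connect1; rewrite /= partialE edge_of_val iA.
Qed.

Lemma orbits_partial A : (orbits (partial A) + #|A| = #|T|)%N.
Proof.
elim/subset_ind: A => [|A i iA IH].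
  have -> : partial set0 = 1%g.
    by apply/permP=> d; rewrite partialE inE perm1.
  by rewrite cards0 addn0; apply: orbits1.
have := split_genus r (_ : val i != m (val i)) (mem_porbit_partial (setU11 i A)).
rewrite eq_sym (matching_neq hm) -partial_remove // => /(_ isT) [E _].
by rewrite cardsU1 iA -IH E addSnnS.
Qed.

Lemma spherical_partial A : spherical r m -> spherical r (partial A).
Proof.
move=> sph; rewrite -[A]setCK; elim/subset_ind: (~: A) => [|B i iB IH].
  by rewrite setC0 partialT.
have iA : i \notin ~: (i |: B) by rewrite !inE eqxx.
have E : i |: ~: (i |: B) = ~: B.
  apply/setP=> j; rewrite !inE negb_or; case: eqP => [->|//]; by rewrite iB.
rewrite (partial_remove iA) E; apply/sphericalC/spherical_split.
- by rewrite eq_sym (matching_neq hm).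
- by rewrite -fconnect_porbit; apply: connect1; rewrite /= partialE
    edge_of_val inE iB.
exact/sphericalC.
Qed.

Let ends := edge_ends id (m := m).

Lemma connect_partial A :
  connect (map_rel r (partial A)) =2 connect (edge_rel (frel r) ends A).
Proof.
move=> u v; apply/idP/idP; apply: connect_sub => {}u {}v.
  case/orP=> /eqP ->; first by apply: connect1; rewrite /edge_rel /= eqxx.
  rewrite partialE; case: ifP => [uA|_]; last exact: connect0.
  apply: connect1; apply/orP; right; apply/existsP; exists (edge_of hm u).
  rewrite uA /ends /edge_ends val_edge_of; case: ifP => _; rewrite ?eqxx //.
  by rewrite (matching_invol hm) eqxx orbT.
case/orP=> [/eqP <-|/existsP[i /andP[iA]]].
  by apply: connect1; rewrite /map_rel /= eqxx.
rewrite /ends /edge_ends => /orP[]/eqP[<- <-]; apply: connect1; apply/orP; right;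
  rewrite partialE ?edge_of_m edge_of_val iA //.
by rewrite (matching_invol hm).
Qed.

(** A ribbon subgraph of a graph on a sphere is again of genus 0. *)
Lemma orbits_faces A : spherical r m ->
  (orbits (partial A * r) + orbits r =
   #|A| + 2 * #|components (edge_rel (frel r) ends A)|)%N.
Proof.
move/(spherical_partial A); rewrite /spherical orbits_mulC /map_components.
rewrite (eq_components (connect_partial A)) -(orbits_partial A).
move: (orbits _) (orbits _) (orbits _) => a b c; lia.
Qed.

(** Twice the Pauli matrices over [F5], where 2 is a square root of -1. *)
Definition rho (c : color) (a b : bool) : F5 :=
  match c with
  | None => if a == b then 0 else 2
  | Some true => if a == b then (if a then -2 else 2) else 0
  | Some false => if a == b then 0 else (if a then -1 else 1)
  end.

Lemma rho_completeness a b c d :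
  \sum_k rho k a b * rho k c d =
  ((a == b) && (c == d))%:R - 2 * ((a == d) && (b == c))%:R.
Proof.
by rewrite sum_color; case: a; case: b; case: c; case: d; apply: val_inj.
Qed.

(** Each set [A] of edges contributes, up to sign, 4 to the power of its cycle
    rank.  By [orbits_faces] this is 2 for each boundary component, up to factors
    2 for the edges and 1/2 for the vertices.  Now 2 to the number of boundary
    components counts the functions [y] on the corners of the map that are
    constant along the boundary of [A].  For a fixed [y] the sum over [A] factors over the edges, and
    [rho_completeness] writes each factor as a sum over three colours. *)
Theorem spherical_colorings : spherical r m ->
  \sum_(l : {ffun T -> color} | minv m l)
    \prod_(C in components (frel r)) parity_weight (\sum_(d in C) count_color (l d)) =
  2 ^+ orbits r * \sum_(l : {ffun T -> color} | minv m l)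
    \sum_(y : {ffun T -> bool}) \prod_d rho (l d) (y d) (y (r d)).
Proof.
move=> sph.
have := half_edge_expansion parity_link parity_loop parity0
  (perm_connect_sym r) id hm None.
move=> ->; rewrite -/ends.
pose P (A : {set edge m}) (y : {ffun T -> bool}) := \prod_(i : edge m)
  (if i \in A then - 2 * ((y (val i) == y (r (m (val i)))) &&
                         (y (r (val i)) == y (m (val i))))%:R
   else ((y (val i) == y (r (val i))) &&
         (y (m (val i)) == y (r (m (val i)))))%:R : F5).
transitivity (2 ^+ orbits r * \sum_(y : {ffun T -> bool}) \sum_(A : {set edge m}) P A y).
  rewrite exchange_big /= mulr_sumr; apply: eq_bigr => A _.
  have -> : \sum_y P A y = (-2) ^+ #|A| * 2 ^+ orbits (partial A * r).
    have := card_invariant bool (partial A * r); rewrite card_bool => cI.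
    have -> : 2 ^+ orbits (partial A * r) =
        \sum_(y : {ffun T -> bool}) (minv (partial A * r)%g y)%:R :> F5.
      rewrite -natrX -cI -sum1_card natr_sum big_mkcond.
      by apply: eq_bigr => y _; rewrite inE; case: (minv _ y).
    rewrite mulr_sumr; apply: eq_bigr => y _.
    rewrite /P; pose b i := if i \in A then (y (val i) == y (r (m (val i)))) &&
                         (y (r (val i)) == y (m (val i)))
       else (y (val i) == y (r (val i))) && (y (m (val i)) == y (r (m (val i)))).
    have -> : minv (partial A * r)%g y = [forall i, b i].
      apply/minvP/forallP => [H i|H d].
        have := H (val i); have := H (m (val i)).
        rewrite !permM !partialE edge_of_m edge_of_val /b (matching_invol hm).
        by case: ifP => _ -> ->; rewrite !eqxx.
      have := H (edge_of hm d); rewrite permM partialE /b val_edge_of.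
      case: (_ \in A); case: (first_end m d); rewrite ?(matching_invol hm) => /andP[/eqP E1 /eqP E2];
        by rewrite ?E1 ?E2.
    transitivity (\prod_i ((if i \in A then -2 else 1 : F5) * (b i)%:R)).
      by apply: eq_bigr => i _; rewrite /b; case: ifP => //; rewrite mul1r.
    rewrite big_split /= prod_bool -big_mkcond prodr_const /=.
    by case: [forall i, b i].
  rewrite mulrCA -exprD addnC orbits_faces // exprD mulrA -exprMn exprM.
  have -> : - 4%:R = 1 :> F5 by exact/val_inj.
  have -> : -2 * 2 = 1 :> F5 by exact/val_inj.
  have -> : 2 ^+ 2 = -1 :> F5 by exact/val_inj.
  by rewrite !expr1n.
congr (_ * _); rewrite [RHS]exchange_big /=; apply: eq_bigr => y _.
rewrite -bigA_distr /=.
under [RHS]eq_bigr => l _ do rewrite -[\prod_d _]/(\prod_d (fun c d => rho c (y d) (y (r d))) (l d) d).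
rewrite -(prod_edge_expand hm (fun c d => rho c (y d) (y (r d)))).
apply: eq_bigr => i _; rewrite rho_completeness addrC mulNr.
by [].
Qed.

End PartialMatching.

(** * Cubic diagrams *)

Section CubicDiagram.
Variable D : diagram.
Hypothesis hrot : is_rotation (@dbase D) (@drot D).
Hypothesis hd : is_matching (@darc D : dend D -> dend D).

Lemma drot_inj : injective (@drot D).
Proof.
have onto (h : dhalf D) : exists h', drot h' = h.
  have: fconnect (@drot D) (drot h) h.
    by rewrite hrot eq_sym -hrot fconnect1.
  move/iter_findex; set n := findex _ _ _ => E.
  by exists (iter n (@drot D) h); rewrite -iterS iterSr.
have /imset_injP inj : #|@drot D @: setT| == #|[set: dhalf D]|.
  rewrite (_ : _ @: setT = setT) //; apply/setP=> h; rewrite [RHS]inE.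
  by have [h' <-] := onto h; apply: imset_f.
by move=> h h'; apply: inj.
Qed.

Variable corner : dvertex D -> dhalf D.
Hypothesis cornerE : forall v, dbase (corner v) = v.
Hypothesis deg3 : forall v : dvertex D, #|[set h | dbase h == v]| = 3%N.

Definition corner1 v : dhalf D := drot (corner v).
Definition corner2 v : dhalf D := drot (corner1 v).

Lemma order3 h : fingraph.order (@drot D) h = 3%N.
Proof.
rewrite -(deg3 (dbase h)) /fingraph.order; apply: eq_card => h'.
by rewrite !inE [LHS]hrot eq_sym.
Qed.

Lemma corner_cycle v : drot (corner2 v) = corner v.
Proof. by have := iter_order drot_inj (corner v); rewrite order3. Qed.

Lemma fibre_corners v :
  [pred h | dbase h == v] =i [:: corner v; corner1 v; corner2 v].
Proof.
move=> h; have -> : [:: corner v; corner1 v; corner2 v] = fingraph.orbit (@drot D) (corner v).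
  by rewrite /fingraph.orbit order3.
by rewrite -fconnect_orbit hrot cornerE inE eq_sym.
Qed.

Lemma uniq_corners v : uniq [:: corner v; corner1 v; corner2 v].
Proof.
have -> : [:: corner v; corner1 v; corner2 v] = fingraph.orbit (@drot D) (corner v).
  by rewrite /fingraph.orbit order3.
exact: fingraph.orbit_uniq.
Qed.

Lemma big_corners R (idx : R) (op : Monoid.com_law idx) (F : dhalf D -> R) v :
  \big[op/idx]_(h | dbase h == v) F h =
  op (F (corner v)) (op (F (corner1 v)) (F (corner2 v))).
Proof.
rewrite (eq_bigl _ _ (fibre_corners v)) -big_uniq ?uniq_corners //.
by rewrite !big_cons big_nil Monoid.mulm1.
Qed.

Lemma dbase_corner1 v : dbase (corner1 v) = v.
Proof.
by apply/eqP; have := fibre_corners v (corner1 v); rewrite !inE eqxx orbT.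
Qed.

Lemma dbase_corner2 v : dbase (corner2 v) = v.
Proof.
by apply/eqP; have := fibre_corners v (corner2 v); rewrite !inE eqxx !orbT.
Qed.

Lemma prod_ends (R : comNzRingType) (F : dend D -> R) :
  \prod_d F d = (\prod_v (F (inl (corner v)) * F (inl (corner1 v)) * F (inl (corner2 v)))) *
    \prod_x (F (inr (x, o0)) * F (inr (x, o1)) * F (inr (x, o2)) * F (inr (x, o3))).
Proof.
rewrite big_sumType /=; congr (_ * _).
  rewrite (partition_big (@dbase D) predT) //=; apply: eq_bigr => v _.
  by rewrite big_corners /= mulrA.
rewrite (eq_bigr (fun p => (fun x i => F (inr (x, i))) p.1 p.2)); last by case.
rewrite -(pair_bigA _ (fun x i => F (inr (x, i)))) /=; apply: eq_bigr => x _.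
by rewrite big_ord4 /= !mulrA.
Qed.

Section LocalSums.
Variables (B : finType) (R : comNzRingType).
Variables (f : dvertex D -> B -> B -> B -> R) (g : crossing D -> B -> B -> B -> B -> R).

Definition at_corners T (F : B -> B -> B -> T) (y : {ffun dend D -> B}) v : T :=
  F (y (inl (corner v))) (y (inl (corner1 v))) (y (inl (corner2 v))).

Let assemble (uz : {ffun dvertex D -> B * B * B} * {ffun crossing D -> B * B * B * B}) :
    {ffun dend D -> B} :=
  [ffun d => match d with
   | inl h => let: (a, b, c) := uz.1 (dbase h) in
       if h == corner (dbase h) then a else if h == corner1 (dbase h) then b else c
   | inr (x, i) => let: (a, b, c, d) := uz.2 x in
       if i == o0 then a else if i == o1 then b else if i == o2 then c else d
   end].

Let disassemble (y : {ffun dend D -> B}) :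
    {ffun dvertex D -> B * B * B} * {ffun crossing D -> B * B * B * B} :=
  ([ffun v => at_corners (fun a b c => (a, b, c)) y v],
   [ffun x => at_crossing (fun a b c d => (a, b, c, d)) y x]).

Let disassembleK : cancel disassemble assemble.
Proof.
move=> y; apply/ffunP=> -[h|[x i]]; rewrite !ffunE /=; last first.
  by rewrite /at_crossing; elim/ord4_ind: i.
rewrite /at_corners; have := fibre_corners (dbase h) h; rewrite !inE eqxx.
by case: eqP => [<- //|_]; case: eqP => [<- //|_] /= /esym/eqP <-.
Qed.

Let assembleK : cancel assemble disassemble.
Proof.
case=> u z; rewrite /disassemble.
suff [E1 E2] : (forall v, at_corners (fun a b c => (a, b, c)) (assemble (u, z)) v = u v) /\
    (forall x, at_crossing (fun a b c d => (a, b, c, d)) (assemble (u, z)) x = z x).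
  by congr pair; apply/ffunP=> ?; rewrite ffunE.
split=> [v|x].
  rewrite /at_corners !ffunE cornerE dbase_corner1 dbase_corner2 !eqxx.
  have := uniq_corners v; rewrite /= !inE negb_or !andbT.
  rewrite [corner1 v == corner v]eq_sym [corner2 v == corner v]eq_sym.
  rewrite [corner2 v == corner1 v]eq_sym.
  by case/andP=> /andP[/negPf -> /negPf ->] /negPf ->; case: (u v) => [[]].
by rewrite /at_crossing !ffunE /=; case: (z x) => [[[]]].
Qed.

Lemma sum_local :
  \sum_(y : {ffun dend D -> B})
     (\prod_v at_corners (f v) y v) * \prod_x at_crossing (g x) y x =
  (\prod_v \sum_a \sum_b \sum_c f v a b c) *
  (\prod_x \sum_a \sum_b \sum_c \sum_d g x a b c d).
Proof.
rewrite (reindex assemble); last by exists disassemble => y _; [apply: assembleK|apply: disassembleK].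
transitivity (\sum_(uz : {ffun dvertex D -> B * B * B} * {ffun crossing D -> B * B * B * B})
  (\prod_v f v (uz.1 v).1.1 (uz.1 v).1.2 (uz.1 v).2) *
  (\prod_x g x (uz.2 x).1.1.1 (uz.2 x).1.1.2 (uz.2 x).1.2 (uz.2 x).2)).
  apply: eq_bigr => uz _; congr (_ * _); apply: eq_bigr => i _.
    have := congr1 (fun p : {ffun dvertex D -> B * B * B} * _ => p.1 i) (assembleK uz).
    rewrite [LHS]ffunE.
    by rewrite /at_corners => <-.
  have := congr1 (fun p : _ * {ffun crossing D -> B * B * B * B} => p.2 i) (assembleK uz).
  rewrite [LHS]ffunE.
  by rewrite /at_crossing => <-.
rewrite -(pair_bigA _ (fun (u : {ffun dvertex D -> B * B * B})
    (z : {ffun crossing D -> B * B * B * B}) =>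
  (\prod_v f v (u v).1.1 (u v).1.2 (u v).2) *
  (\prod_x g x (z x).1.1.1 (z x).1.1.2 (z x).1.2 (z x).2))) /=.
under eq_bigr => u _ do rewrite -mulr_sumr.
rewrite -mulr_suml; congr (_ * _).
  rewrite -(bigA_distr_bigA (fun v (p : B * B * B) => f v p.1.1 p.1.2 p.2)).
  apply: eq_bigr => v _.
  rewrite -(pair_bigA _ (fun (p : B * B) c => f v p.1 p.2 c)) /=.
  by rewrite -(pair_bigA _ (fun a b => \sum_c f v a b c)).
rewrite -(bigA_distr_bigA (fun x (p : B * B * B * B) => g x p.1.1.1 p.1.1.2 p.1.2 p.2)).
apply: eq_bigr => x _.
rewrite -(pair_bigA _ (fun (p : B * B * B) d => g x p.1.1 p.1.2 p.2 d)) /=.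
rewrite -(pair_bigA _ (fun (p : B * B) c => \sum_d g x p.1 p.2 c d)) /=.
by rewrite -(pair_bigA _ (fun a b => \sum_c \sum_d g x a b c d)).
Qed.

End LocalSums.
End CubicDiagram.

(** * The value at 1 *)

Lemma ordS4E : (ordS o0 = o1) * (ordS o1 = o2) * (ordS o2 = o3) * (ordS o3 = o0).
Proof. by do !split; apply: val_inj. Qed.

Section States.
Variable D : diagram.
Hypothesis hrot : is_rotation (@dbase D) (@drot D).
Hypothesis hd : is_matching (@darc D : dend D -> dend D).
Variable corner : dvertex D -> dhalf D.
Hypothesis cornerE : forall v, dbase (corner v) = v.
Hypothesis deg3 : forall v : dvertex D, #|[set h | dbase h == v]| = 3%N.

Definition local_turn (o : option bool) (i : 'I_4) : 'I_4 :=
  if smoothing o is Some g then g i else ordS i.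

(** The rotation of the planar map in which the ends of a smoothed crossing
    are grouped into two vertices of degree 2. *)
Definition state_turn (s : state D) (d : dend D) : dend D :=
  match d with
  | inl h => inl (drot h)
  | inr (x, i) => inr (x, local_turn (s x) i)
  end.

Lemma local_turn_inj o : injective (local_turn o).
Proof.
rewrite /local_turn; case E: (smoothing o) => [g|]; last exact: (can_inj (@ordSK 4)).
exact: matching_inj (smoothing_matching E).
Qed.

Lemma state_turn_inj s : injective (state_turn s).
Proof.
case=> [h|[x i]] [h'|[x' i']] //= [].
  by move/(drot_inj hrot) ->.
by move=> <- /local_turn_inj ->.
Qed.

Definition state_rot s : {perm dend D} := perm (@state_turn_inj s).
Definition arc_perm : {perm dend D} := perm (matching_inj hd).

Lemma state_rotE s d : state_rot s d = state_turn s d.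
Proof. by rewrite permE. Qed.

Lemma arc_permE d : arc_perm d = darc d. Proof. by rewrite permE. Qed.

Lemma arc_perm_matching : is_matching arc_perm.
Proof.
by split=> d; rewrite !arc_permE ?(matching_invol hd) ?(matching_neq hd).
Qed.

Lemma spherical_unsmoothed : genus0 (@turn D) (@darc D : dend D -> dend D) ->
  spherical (state_rot [ffun=> None]) arc_perm.
Proof.
have turnE d : state_rot [ffun=> None] d = turn d.
  by rewrite permE; case: d => [//|[x i]] /=; rewrite ffunE.
rewrite /genus0 /spherical [orbits (_ * _)]orbits_mulC -!fcard_orbits /map_components => G.
have faceE : (arc_perm * state_rot [ffun=> None])%g =1 @turn D \o @darc D.
  by move=> d; rewrite permM turnE arc_permE.
rewrite (eq_fcard turnE) (eq_fcard arc_permE) (eq_fcard faceE).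
rewrite card_components; last exact: map_rel_sym.
rewrite (@eq_n_comp _ (map_rel _ arc_perm) [rel x y | (y == turn x) || (y == darc x)]) //.
by apply: eq_connect => x y; rewrite /map_rel /= turnE arc_permE.
Qed.

(** A smoothing splits the cycle of a crossing by the transposition of two
    opposite ends. *)
Lemma spherical_state s : genus0 (@turn D) (@darc D : dend D -> dend D) ->
  spherical (state_rot s) arc_perm.
Proof.
move=> G; have [n] := ubnP #|[set x | isSome (s x)]|.
elim: n s => // n IH s sn.
case: (pickP (fun x => isSome (s x))) => [x sx|none]; last first.
  rewrite (_ : s = [ffun=> None]); first exact: spherical_unsmoothed.
  by apply/ffunP=> x; rewrite ffunE; have := none x; case: (s x).
pose s' : state D := [ffun y => if y == x then None else s y].
have {}IH : spherical (state_rot s') arc_perm.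
  apply: IH; apply: leq_trans (_ : #|[set x | isSome (s x)]| <= n)%N => //.
  apply: proper_card; apply/properP; split.
    by apply/subsetP=> y; rewrite !inE ffunE; case: eqP.
  by exists x; rewrite !inE ?ffunE ?eqxx.
have rot'E i : state_rot s' (inr (x, i)) = inr (x, ordS i).
  by rewrite permE /= ffunE eqxx.
(* The smoothing 0 exchanges the images of the ends 1 and 3 under the rotation,
   and the smoothing 1 those of the ends 0 and 2. *)
pose a : dend D := inr (x, if s x == Some false then o1 else o0).
pose b : dend D := inr (x, if s x == Some false then o3 else o2).
have -> : state_rot s = (tperm a b * state_rot s')%g.
  apply/permP=> d; rewrite permM state_rotE.
  case: (tpermP a b d) => [->|->|da db].
  - rewrite rot'E /= /local_turn; case: (s x) sx => [[]|] //= _.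
      by rewrite smooth1E ordS4E.
    by rewrite smooth0E ordS4E.
  - rewrite rot'E /= /local_turn; case: (s x) sx => [[]|] //= _.
      by rewrite smooth1E ordS4E.
    by rewrite smooth0E ordS4E.
  rewrite state_rotE; case: d da db => [//|[y i]] /=; rewrite ffunE.
  case: eqP => [->|//]; rewrite /a /b /local_turn; case: (s x) sx => [[]|] //= _.
    by elim/ord4_ind: i; rewrite ?smooth1E ?ordS4E.
  by elim/ord4_ind: i; rewrite ?smooth0E ?ordS4E.
apply: spherical_split IH.
  by apply/eqP; rewrite /a /b; case: (s x == _) => -[].
rewrite -fconnect_porbit.
have -> : b = iter 2 (state_rot s') a.
  by rewrite /= /a !rot'E /b; case: (s x == _); rewrite !ordS4E.
exact: fconnect_iter.
Qed.

(** The vertices of the map of a state, with a boolean telling apart the two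
    vertices that replace a smoothed crossing. *)
Definition state_base (s : state D) (d : dend D) : dvertex D + crossing D * bool :=
  match d with
  | inl h => inl (dbase h)
  | inr (x, i) => inr (x, match s x with
      | None => false
      | Some false => (i == o2) || (i == o3)
      | Some true => (i == o3) || (i == o0)
      end)
  end.

Lemma fconnect_state_rot s d d' :
  fconnect (state_rot s) d d' = (state_base s d == state_base s d').
Proof.
apply/idP/eqP => [/connectP[p]|].
  have step e : state_base s (state_rot s e) = state_base s e.
    rewrite state_rotE; case: e => [h|[x i]] /=.
      by congr inl; apply/eqP; rewrite -hrot (fconnect_sym (drot_inj hrot)) fconnect1.
    rewrite /local_turn; case: (s x) => [[]|] //=;
      by elim/ord4_ind: i; rewrite ?smooth0E ?smooth1E.
  elim: p d => [|z p IH] d /=; first by move=> _ ->.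
  by case/andP=> /eqP <- pth /(IH _ pth) <-; rewrite step.
case: d d' => [h|[x i]] [h'|[x' i']] //=.
  case=> /eqP; rewrite -hrot => /connectP[p pth ->].
  have -> : inl (last h p) = last (inl h) (map inl p) :> dend D by rewrite last_map.
  apply/connectP; exists (map inl p) => //.
  rewrite path_map; apply: sub_path pth => u w /eqP <-.
  by rewrite /= state_rotE.
case=> <-; have it n j k : iter n (local_turn (s x)) j = k ->
    fconnect (state_rot s) (inr (x, j)) (inr (x, k)).
  move=> <-; have -> : inr (x, iter n (local_turn (s x)) j) =
      iter n (state_rot s) (inr (x, j)) :> dend D.
    by elim: n => //= n <-; rewrite state_rotE.
  exact: fconnect_iter.
move: it; rewrite /local_turn; case: (s x) => [[]|] /= it;
  elim/ord4_ind: i; elim/ord4_ind: i' => //= _;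
  solve [exact: (it 0%N)
    | by apply: (it 1%N); rewrite /= ?smooth0E ?smooth1E ?ordS4E
    | by apply: (it 2); rewrite /= ?ordS4E
    | by apply: (it 3); rewrite /= ?ordS4E].
Qed.

End States.

Definition vertex_trace (a b c : color) (x y z : bool) : F5 :=
  2 * (rho a x y * rho b y z * rho c z x).

Definition state_trace (o : option bool) (a b c d : color) (x y z w : bool) : F5 :=
  match o with
  | None => 2 * (rho a x y * rho b y z * rho c z w * rho d w x)
  | Some false => 4 * (rho a x y * rho b y x * rho c z w * rho d w z)
  | Some true => 4 * (rho a x w * rho b y z * rho c z y * rho d w x)
  end.

(** Up to a global sign, the orientation of three colours. *)
Definition orient (a b c : color) : F5 :=
  match a, b, c with
  | None, Some true, Some false | Some true, Some false, None
  | Some false, None, Some true => 1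
  | None, Some false, Some true | Some true, None, Some false
  | Some false, Some true, None => -1
  | _, _, _ => 0
  end.

Lemma color_ind (P : color -> Prop) :
  P None -> P (Some true) -> P (Some false) -> forall c, P c.
Proof. by move=> H1 H2 H3 [[]|]. Qed.

(** Three distinct Pauli matrices multiply to a square root of -1, with a sign
    that depends on their cyclic order. *)
Lemma vertex_traceE a b c :
  \sum_x \sum_y \sum_z vertex_trace a b c x y z = orient a b c.
Proof.
rewrite !big_bool /vertex_trace.
by elim/color_ind: a; elim/color_ind: b; elim/color_ind: c; apply/val_inj.
Qed.

(** A trace of four Pauli matrices is an alternating sum of the three pairings
    of their indices, and the two smoothings cancel two of these. *)
Lemma state_traceE a b c d :
  \sum_x \sum_y \sum_z \sum_w \sum_o state_trace o a b c d x y z w =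
  ((a == c) && (b == d))%:R.
Proof.
rewrite !big_bool !big_option !big_bool /state_trace.
by elim/color_ind: a; elim/color_ind: b; elim/color_ind: c; elim/color_ind: d;
  apply/val_inj; lazy.
Qed.

#[local] Arguments parity_weight : simpl never.
#[local] Arguments count_color : simpl never.

Section ValueAtOne.
Variable D : diagram.
Hypothesis hrot : is_rotation (@dbase D) (@drot D).
Hypothesis hd : is_matching (@darc D : dend D -> dend D).
Hypothesis hgenus : genus0 (@turn D) (@darc D : dend D -> dend D).
Variable corner : dvertex D -> dhalf D.
Hypothesis cornerE : forall v, dbase (corner v) = v.
Hypothesis deg3 : forall v : dvertex D, #|[set h | dbase h == v]| = 3%N.

Let rot (s : state D) : {perm dend D} := state_rot hrot s.
Let arcs : {perm dend D} := arc_perm hd.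

Definition fibre s n : {set dend D} := [set d | state_base s d == n].

Lemma prod_state_components (s : state D) (F : {set dend D} -> F5) :
  \prod_(C in components (frel (rot s))) F C =
  (\prod_v F (fibre s (inl v))) *
  \prod_x (F (fibre s (inr (x, false))) *
           if isSome (s x) then F (fibre s (inr (x, true))) else 1).
Proof.
rewrite (big_components_fibres _ _ (fconnect_state_rot hrot s)) big_sumType /=.
congr (_ * _).
  apply: eq_bigl => v; apply/imsetP; exists (inl (corner v)) => //=.
  by rewrite cornerE.
transitivity (\prod_x \prod_(b | inr (x, b) \in state_base s @: dend D) F (fibre s (inr (x, b)))).
  rewrite (pair_big_dep predT (fun x b => inr (x, b) \in state_base s @: dend D)
    (fun x b => F (fibre s (inr (x, b))))) /=.
  by apply: eq_big => -[x b].
apply: eq_bigr => x _; rewrite big_mkcond big_bool /= mulrC; congr (_ * _).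
  case: imsetP => [//|[]]; exists (inr (x, if s x == Some false then o0 else o1)) => //=.
  by case: (s x) => [[]|].
case E: (s x) => [b|] /=.
  case: imsetP => [//|[]]; exists (inr (x, if b then o0 else o2)) => //=.
  by rewrite E; case: b {E}.
case: imsetP => // -[[h|[y i]] _] //= [<-]; by rewrite E.
Qed.

Lemma sum_fibre_vertex s (G : dend D -> counts) v :
  \sum_(d in fibre s (inl v)) G d = \sum_(h | dbase h == v) G (inl h).
Proof.
rewrite big_sumType /= [X in _ + X]big1 ?addr0; last by move=> [x i]; rewrite inE.
by apply: eq_bigl => h; rewrite inE.
Qed.

Lemma sum_fibre_crossing s (G : dend D -> counts) x b :
  \sum_(d in fibre s (inr (x, b))) G d =
  \sum_(i | match s x with
             | None => false
             | Some false => (i == o2) || (i == o3)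
             | Some true => (i == o3) || (i == o0)
             end == b) G (inr (x, i)).
Proof.
rewrite big_sumType /= [X in X + _]big1 ?add0r; last by move=> h; rewrite inE.
rewrite (reindex_onto (fun i => (x, i)) snd) /=; last first.
  by case=> y i; rewrite inE => /eqP[->].
apply: eq_bigl => i; rewrite inE eqxx andbT /=.
by apply/eqP/eqP => [[]|->].
Qed.

Lemma parity_pair a b : parity_weight (count_color a + count_color b) = (a == b)%:R.
Proof. by elim/color_ind: a; elim/color_ind: b; apply/val_inj. Qed.

Lemma parity_components (s : state D) (l : {ffun dend D -> color}) :
  \prod_(C in components (frel (rot s))) parity_weight (\sum_(d in C) count_color (l d)) =
  at_vertices count_color parity_weight l *
  \prod_x at_crossing (local_state count_color parity_weight (s x)) l x.
Proof.
rewrite prod_state_components; congr (_ * _).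
  by apply: eq_bigr => v _; rewrite sum_fibre_vertex.
apply: eq_bigr => x _; rewrite !sum_fibre_crossing.
rewrite [\sum_(i < 4 | _) _]big_mkcond !big_ord4.
rewrite /at_crossing; case: (s x) => [[]|] /=; rewrite ?[\sum_(i < 4 | _) _]big_mkcond ?big_ord4 /=.
- rewrite !add0r !addr0 !parity_pair -natrM mulnb; congr (nat_of_bool _)%:R.
  by rewrite [_ == l (inr (x, o0))]eq_sym.
- by rewrite !add0r !addr0 !parity_pair -natrM mulnb.
by rewrite mulr1 !addrA.
Qed.

Lemma orbits_state_rot (s : state D) :
  2 ^+ orbits (rot s) =
  (\prod_(v : dvertex D) 2) * \prod_x (if isSome (s x) then 4 else 2) :> F5.
Proof.
rewrite /orbits porbits_components -prodr_const prod_state_components.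
congr (_ * _); apply: eq_bigr => x _; case: (isSome (s x)); last exact: mulr1.
exact/val_inj.
Qed.

Lemma trace_state (s : state D) (l : {ffun dend D -> color}) (y : {ffun dend D -> bool}) :
  2 ^+ orbits (rot s) * \prod_d rho (l d) (y d) (y (rot s d)) =
  (\prod_v at_corners corner (at_corners corner vertex_trace l v) y v) *
  \prod_x at_crossing (at_crossing (state_trace (s x)) l x) y x.
Proof.
rewrite orbits_state_rot (prod_ends hrot cornerE deg3) mulrACA -!big_split /=.
congr (_ * _); apply: eq_bigr => n _; rewrite !permE /=.
  by rewrite -/(corner1 corner n) -/(corner2 corner n) (corner_cycle hrot _ deg3).
rewrite /at_crossing /local_turn.
by case: (s n) => [[]|] /=; rewrite ?smooth0E ?smooth1E ?ordS4E.
Qed.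

(** This is Penrose's signed count of the 3-edge-colourings of the abstract
    ribbon graph: the crossings have no other effect than to carry colours
    straight through. *)
Theorem yamada_at_1 :
  (yamada D (1 : int))%:~R = 3 ^+ dcircles D *
  \sum_(l : {ffun dend D -> color} | minv (@darc D) l)
    (\prod_v at_corners corner orient l v) *
    \prod_x at_crossing (fun a b c d => ((a == c) && (b == d))%:R) l x :> F5.
Proof.
have Q4 : (1 + 2 + 1^-1)%:~R = 4 :> F5 by exact/val_inj.
have cardL : #|color| = 3%N by rewrite !card_option card_bool.
have H s : (planar_yamada (state_graph s) (1 : int))%:~R = 3 ^+ dcircles D *
   (2 ^+ orbits (rot s) * \sum_(l : {ffun dend D -> color} | minv (@darc D) l)
    \sum_(y : {ffun dend D -> bool}) \prod_d rho (l d) (y d) (y (rot s d))).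
  rewrite (state_network (x := count_color) (t := parity_weight) None) //.
  - rewrite cardL; congr (_ * _).
    have ml (l : {ffun dend D -> color}) : minv (@darc D) l = minv arcs l.
      by apply: eq_forallb => d; rewrite arc_permE.
    under eq_bigr => l _ do rewrite -parity_components.
    rewrite (eq_bigl (fun l : {ffun dend D -> color} => minv arcs l)) //.
    rewrite (spherical_colorings (arc_perm_matching hd)); last exact: spherical_state.
    by congr (_ * _); apply: eq_bigl => l; rewrite ml.
  - exact: parity_link.
  - by move=> a; rewrite Q4; apply: parity_loop.
  - exact: parity0.
  - by rewrite cardL Q4; apply/val_inj.
rewrite /yamada rmorph_sum /=.
under eq_bigr => s _ do rewrite exp1rz mul1r H.
rewrite -mulr_sumr; congr (_ * _).
under [LHS]eq_bigr => s _ do rewrite mulr_sumr.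
rewrite exchange_big /=; apply: eq_bigr => l _.
under eq_bigr => s _ do (rewrite mulr_sumr; under eq_bigr => y _ do rewrite trace_state).
rewrite exchange_big /=.
transitivity (\sum_(y : {ffun dend D -> bool})
  (\prod_v at_corners corner (at_corners corner vertex_trace l v) y v) *
  \prod_x at_crossing (fun a b c d => \sum_o at_crossing (state_trace o) l x a b c d) y x).
  apply: eq_bigr => y _; rewrite -mulr_sumr; congr (_ * _).
  by rewrite -(bigA_distr_bigA (fun x o => at_crossing (at_crossing (state_trace o) l x) y x)).
rewrite (sum_local hrot cornerE deg3 (fun v => at_corners corner vertex_trace l v)
  (fun x a b c d => \sum_o at_crossing (state_trace o) l x a b c d)).
congr (_ * _); apply: eq_bigr => i _; first exact: vertex_traceE.
exact: state_traceE.
Qed.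

End ValueAtOne.

(** * Derivations of label networks *)

Section Derivations.
Variables (R : comNzRingType) (T L J : finType) (act : J -> L -> L -> R).
Hypothesis act_anti : forall j a b, act j a b = - act j b a.

Definition relabel (l : {ffun T -> L}) d a : {ffun T -> L} :=
  [ffun e => if e == d then a else l e].

(** The action of the Lie algebra element [j] on the tensor factor of the end
    [d]. *)
Definition derive_at j d (F : {ffun T -> L} -> R) (l : {ffun T -> L}) : R :=
  \sum_a act j a (l d) * F (relabel l d a).

Lemma derive_by_parts j d (F G : {ffun T -> L} -> R) :
  \sum_l F l * derive_at j d G l = - \sum_l derive_at j d F l * G l.
Proof.
rewrite -sumrN.
under eq_bigr => l _ do rewrite mulr_sumr.
under [RHS]eq_bigr => l _ do rewrite mulr_suml -sumrN.
rewrite !pair_bigA /=.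
have relabelK : involutive (fun p : {ffun T -> L} * L => (relabel p.1 d p.2, p.1 d)).
  case=> l a /=; congr (_, _); last by rewrite ffunE eqxx.
  by apply/ffunP=> e; rewrite !ffunE; case: eqP => // ->.
rewrite (reindex_inj (inv_inj relabelK)) /=; apply: eq_bigr => -[l a] _ /=.
have -> : relabel (relabel l d a) d (l d) = l.
  by apply/ffunP=> e; rewrite !ffunE; case: eqP => // ->.
by rewrite ffunE eqxx [act j (l d) a]act_anti; ring.
Qed.

Section Nodes.
Variables (N : finType) (node : T -> N).

Definition local (n : N) (F : {ffun T -> L} -> R) : Prop :=
  forall l d a, node d != n -> F (relabel l d a) = F l.

Definition derive_node j n F l : R := \sum_(d | node d == n) derive_at j d F l.

Definition invariant_tensor n F : Prop := forall j l, derive_node j n F l = 0.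

Definition exact_tensor n F : Prop :=
  exists2 u : J -> {ffun T -> L} -> R, (forall j, local n (u j)) &
    forall l, F l = \sum_j derive_node j n (u j) l.

Lemma derive_prod j (F : N -> {ffun T -> L} -> R) l :
  (forall n, local n (F n)) ->
  \sum_d derive_at j d (fun l => \prod_n F n l) l =
  \sum_n derive_node j n (F n) l * \prod_(k | k != n) F k l.
Proof.
move=> loc; rewrite (partition_big node predT) //=; apply: eq_bigr => n _.
rewrite /derive_node mulr_suml; apply: eq_bigr => d /eqP dn.
rewrite /derive_at mulr_suml; apply: eq_bigr => a _.
rewrite (bigD1 n) //= mulrA; congr (_ * _); apply: eq_bigr => k kn.
by rewrite loc // dn eq_sym.
Qed.

End Nodes.

Variables (N : finType) (node : T -> N) (N' : finType) (node' : T -> N').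
Variable G : N' -> {ffun T -> L} -> R.
Hypotheses (G_local : forall n, local node' n (G n))
  (G_inv : forall n, invariant_tensor node' n (G n)).

(** By parts, a sum of derivatives contracted with invariant tensors is zero. *)
Lemma sum_exact n0 (F : N -> {ffun T -> L} -> R) :
    (forall n, local node n (F n)) ->
    (forall n, n != n0 -> invariant_tensor node n (F n)) ->
    exact_tensor node n0 (F n0) ->
  \sum_l (\prod_n F n l) * \prod_n G n l = 0.
Proof.
move=> loc inv [u locu E].
pose Fu j n := if n == n0 then u j else F n.
have locFu j n : local node n (Fu j n) by rewrite /Fu; case: eqP => [->|_].
transitivity (\sum_j \sum_l (\sum_d derive_at j d (fun l => \prod_n Fu j n l) l) *
    \prod_n G n l).
  rewrite exchange_big /=; apply: eq_bigr => l _; rewrite -mulr_suml; congr (_ * _).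
  rewrite (bigD1 n0) //= E mulr_suml; apply: eq_bigr => j _.
  rewrite (derive_prod _ _ (locFu j)) [RHS](bigD1 n0) //= [X in _ = _ + X]big1 ?addr0.
    rewrite /Fu eqxx; congr (_ * _); apply: eq_bigr => n nn0.
    by rewrite (negPf nn0).
  by move=> n nn0; rewrite {1}/Fu (negPf nn0) inv // mul0r.
apply: big1 => j _; under eq_bigr => l _ do rewrite mulr_suml.
rewrite exchange_big /=.
transitivity (- \sum_d \sum_l (\prod_n Fu j n l) * derive_at j d (fun l => \prod_n G n l) l).
  rewrite -sumrN; apply: eq_bigr => d _.
  by rewrite (derive_by_parts j d (fun l => \prod_n Fu j n l)) opprK.
apply/eqP; rewrite oppr_eq0 exchange_big /=; apply/eqP; apply: big1 => l _.
by rewrite -mulr_sumr (derive_prod _ _ G_local) [X in _ * X]big1 ?mulr0 // => n _; rewrite G_inv mul0r.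
Qed.

(** The tensors are changed one node at a time, the others being invariant. *)
Theorem replace_tensors (F F' : N -> {ffun T -> L} -> R) :
    (forall n, local node n (F n)) -> (forall n, local node n (F' n)) ->
    (forall n, invariant_tensor node n (F n)) -> (forall n, invariant_tensor node n (F' n)) ->
    (forall n, exact_tensor node n (fun l => F n l - F' n l)) ->
  \sum_l (\prod_n F n l) * \prod_n G n l = \sum_l (\prod_n F' n l) * \prod_n G n l.
Proof.
move=> loc loc' inv inv' ex.
pose H (A : {set N}) n := if n \in A then F' n else F n.
suff E A : \sum_l (\prod_n F n l) * \prod_n G n l =
    \sum_l (\prod_n H A n l) * \prod_n G n l.
  rewrite (E setT); apply: eq_bigr => l _; congr (_ * _).
  by apply: eq_bigr => n _; rewrite /H inE.
elim/subset_ind: A => [|A n0 n0A ->].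
  apply: eq_bigr => l _; congr (_ * _).
  by apply: eq_bigr => n _; rewrite /H inE.
apply/eqP; rewrite -subr_eq0 -sumrB; apply/eqP.
pose K n := if n == n0 then (fun l => F n l - F' n l) else H A n.
rewrite -[RHS](sum_exact (n0 := n0) (F := K)).
- apply: eq_bigr => l _; rewrite -mulrBl; congr (_ * _).
  rewrite (bigD1 n0) //= [\prod_n H (n0 |: A) n l](bigD1 n0) //=.
  rewrite [RHS](bigD1 n0) //= /K eqxx mulrBl /H setU11 (negPf n0A); congr (_ * _ - _ * _).
    by apply: eq_bigr => n /negPf ->.
  by apply: eq_bigr => n nn0; rewrite in_setU1 (negPf nn0).
- move=> n l d a dn; rewrite /K /H; case: eqP => [_|_]; first by rewrite loc // loc'.
  by case: ifP => _; [apply: loc'|apply: loc].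
- by move=> n /negPf nn0; rewrite /K nn0 /H; case: ifP.
by rewrite /K eqxx.
Qed.

End Derivations.

Section SmallTensors.
Variables (R : comNzRingType) (L J : finType) (act : J -> L -> L -> R).

Definition derive2 j (F : L -> L -> R) a b : R :=
  \sum_e act j e a * F e b + \sum_e act j e b * F a e.

Definition derive3 j (F : L -> L -> L -> R) a b c : R :=
  \sum_e act j e a * F e b c +
  (\sum_e act j e b * F a e c + \sum_e act j e c * F a b e).

Definition derive4 j (F : L -> L -> L -> L -> R) a b c d : R :=
  \sum_e act j e a * F e b c d + (\sum_e act j e b * F a e c d +
  (\sum_e act j e c * F a b e d + \sum_e act j e d * F a b c e)).

Hypothesis act_anti : forall j a b, act j a b = - act j b a.

Lemma sum_act_delta j a b : \sum_e act j e a * (e == b)%:R = act j b a.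
Proof.
rewrite (bigD1 b) //= eqxx mulr1 big1 ?addr0 // => e /negPf ->.
by rewrite mulr0.
Qed.

Lemma sum_act_deltar j a b : \sum_e act j e a * (b == e)%:R = act j b a.
Proof. by rewrite -[RHS]sum_act_delta; apply: eq_bigr => e _; rewrite eq_sym. Qed.

Lemma derive2_delta j a b : derive2 j (fun a b => (a == b)%:R) a b = 0.
Proof. by rewrite /derive2 sum_act_delta sum_act_deltar act_anti addNr. Qed.

Lemma sum_act_scaler j a (f : L -> R) k :
  \sum_e act j e a * (f e * k) = (\sum_e act j e a * f e) * k.
Proof. by rewrite mulr_suml; apply: eq_bigr => e _; rewrite mulrA. Qed.

Lemma sum_act_scalel j a (f : L -> R) k :
  \sum_e act j e a * (k * f e) = k * \sum_e act j e a * f e.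
Proof. by rewrite mulr_sumr; apply: eq_bigr => e _; rewrite mulrCA. Qed.

Lemma derive4_straight j a b c d :
  derive4 j (fun a b c d => (a == c)%:R * (b == d)%:R) a b c d = 0.
Proof.
rewrite /derive4 !sum_act_scaler !sum_act_scalel !sum_act_delta !sum_act_deltar.
by rewrite [act j c a]act_anti [act j d b]act_anti; ring.
Qed.

End SmallTensors.

(** * Networks on a cubic diagram *)

Section DiagramNetworks.
Variable D : diagram.
Hypothesis hrot : is_rotation (@dbase D) (@drot D).
Hypothesis hd : is_matching (@darc D : dend D -> dend D).
Variable corner : dvertex D -> dhalf D.
Hypothesis cornerE : forall v, dbase (corner v) = v.
Hypothesis deg3 : forall v : dvertex D, #|[set h | dbase h == v]| = 3%N.
Variables (R : comNzRingType) (L J : finType) (act : J -> L -> L -> R).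
Hypothesis act_anti : forall j a b, act j a b = - act j b a.

Definition end_node (d : dend D) : dvertex D + crossing D :=
  match d with inl h => inl (dbase h) | inr (x, _) => inr x end.

Definition node_tensor (F3 : L -> L -> L -> R) (F4 : L -> L -> L -> L -> R)
    (n : dvertex D + crossing D) (l : {ffun dend D -> L}) : R :=
  match n with
  | inl v => at_corners corner F3 l v
  | inr x => at_crossing F4 l x
  end.

Definition arc_tensor (F2 : L -> L -> R) (i : edge (@darc D)) (l : {ffun dend D -> L}) : R :=
  F2 (l (val i)) (l (darc (val i))).

Lemma prod_node_tensor F3 F4 l :
  \prod_n node_tensor F3 F4 n l =
  (\prod_v at_corners corner F3 l v) * \prod_x at_crossing F4 l x.
Proof. by rewrite big_sumType. Qed.

Lemma node_tensor_local F3 F4 n : local end_node n (node_tensor F3 F4 n).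
Proof.
have out l d a e : end_node d != n -> end_node e = n -> relabel l d a e = l e.
  by move=> dn en; rewrite ffunE; case: eqP => // E; rewrite -E en eqxx in dn.
move=> l d a dn; case: n dn out => [v|x] dn out /=.
  rewrite /at_corners !out //=.
  - by rewrite (dbase_corner2 hrot cornerE deg3).
  - by rewrite (dbase_corner1 hrot cornerE deg3).
  by rewrite cornerE.
by rewrite /at_crossing !out.
Qed.

Lemma arc_tensor_local F2 i : local (edge_of hd) i (arc_tensor F2 i).
Proof.
move=> l d a; rewrite edge_of_eq negb_or => /andP[n1 n2].
rewrite /arc_tensor !ffunE eq_sym (negPf n1).
by case: eqP => // E; rewrite E eqxx in n2.
Qed.

Lemma derive_arc j F2 i l :
  derive_node act (edge_of hd) j i (arc_tensor F2 i) l =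
  derive2 act j F2 (l (val i)) (l (darc (val i))).
Proof.
have ne : (darc (val i) == val i) = false by apply/negbTE/(matching_neq hd).
rewrite /derive_node (eq_bigl (fun d => (d == val i) || (d == darc (val i)))) => [|d];
  last exact: edge_of_eq.
rewrite (bigD1 (val i)) ?eqxx //= (big_pred1 (darc (val i))) => [|d]; last first.
  by case: eqP => [->|]; rewrite /= ?(eq_sym (val i)) ?ne // andbT.
rewrite /derive2 /derive_at /arc_tensor; congr (_ + _); apply: eq_bigr => a _;
  by rewrite !ffunE !eqxx ?ne // eq_sym ne.
Qed.

Lemma derive_vertex j F3 F4 v l :
  derive_node act end_node j (inl v) (node_tensor F3 F4 (inl v)) l =
  at_corners corner (derive3 act j F3) l v.
Proof.
rewrite /derive_node big_sumType /= [X in _ + X]big1 ?addr0; last by case.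
rewrite (eq_bigl (fun h => dbase h == v)) => [|h]; last first.
  by apply/eqP/eqP => [[]|->].
rewrite (big_corners hrot cornerE deg3) /=.
have := uniq_corners hrot corner deg3 v; rewrite /= !inE negb_or !andbT.
case/andP=> /andP[/negPf n1 /negPf n2] /negPf n3.
have n4 : (corner1 corner v == corner v) = false by rewrite eq_sym.
have n5 : (corner2 corner v == corner v) = false by rewrite eq_sym.
have n6 : (corner2 corner v == corner1 corner v) = false by rewrite eq_sym.
have inlE h h' : ((inl h : dend D) == inl h') = (h == h') by apply/eqP/eqP => [[]|->].
rewrite /derive3 /derive_at /= /at_corners; congr (_ + (_ + _)); apply: eq_bigr => a _;
  by rewrite !ffunE !inlE ?eqxx ?n1 ?n2 ?n3 ?n4 ?n5 ?n6.
Qed.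

Lemma derive_crossing j F3 F4 x l :
  derive_node act end_node j (inr x) (node_tensor F3 F4 (inr x)) l =
  at_crossing (derive4 act j F4) l x.
Proof.
rewrite /derive_node big_sumType /= [X in X + _]big1 ?add0r //.
rewrite (reindex_onto (fun i => (x, i)) snd) /=; last by case=> y i /eqP[->].
rewrite (eq_bigl predT) => [|i]; last by rewrite !eqxx.
have inrE i i' : ((inr (x, i) : dend D) == inr (x, i')) = (i == i').
  by apply/eqP/eqP => [[]|->].
rewrite big_ord4 /derive4 /derive_at /= /at_crossing; congr (_ + (_ + (_ + _)));
  by apply: eq_bigr => a _; rewrite !ffunE !inrE.
Qed.

Variables (F3 : L -> L -> L -> R) (F4 : L -> L -> L -> L -> R) (F2 : L -> L -> R).
Hypotheses (F3_inv : forall j a b c, derive3 act j F3 a b c = 0)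
  (F4_inv : forall j a b c d, derive4 act j F4 a b c d = 0)
  (F2_inv : forall j a b, derive2 act j F2 a b = 0).

Lemma node_tensor_inv n : invariant_tensor act end_node n (node_tensor F3 F4 n).
Proof.
by case: n => [v|x] j l; rewrite ?derive_vertex ?derive_crossing;
  rewrite /at_corners /at_crossing ?F3_inv ?F4_inv.
Qed.

Lemma arc_tensor_inv i : invariant_tensor act (edge_of hd) i (arc_tensor F2 i).
Proof. by move=> j l; rewrite derive_arc F2_inv. Qed.

Theorem replace_crossings (F4' : L -> L -> L -> L -> R) (u : J -> L -> L -> L -> L -> R) :
    (forall j a b c d, derive4 act j F4' a b c d = 0) ->
    (forall a b c d, F4 a b c d - F4' a b c d = \sum_j derive4 act j (u j) a b c d) ->
  \sum_l (\prod_n node_tensor F3 F4 n l) * \prod_i arc_tensor F2 i l =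
  \sum_l (\prod_n node_tensor F3 F4' n l) * \prod_i arc_tensor F2 i l.
Proof.
move=> F4'_inv ex.
apply: (replace_tensors act_anti (node := end_node) (node' := edge_of hd)
  (G := arc_tensor F2) _ _ (F := node_tensor F3 F4) (F' := node_tensor F3 F4')).
- exact: arc_tensor_local.
- exact: arc_tensor_inv.
- exact: node_tensor_local.
- exact: node_tensor_local.
- exact: node_tensor_inv.
- by case=> [v|x] j l; rewrite ?derive_vertex ?derive_crossing;
    rewrite /at_corners /at_crossing ?F3_inv ?F4'_inv.
case=> [v|x].
  exists (fun _ _ => 0) => // l; rewrite subrr big1 // => j _.
  by apply: big1 => d _; apply: big1 => a _; rewrite mulr0.
exists (fun j => node_tensor F3 (u j) (inr x)) => [j|l].
  exact: node_tensor_local.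
rewrite /= /at_crossing ex; apply: eq_bigr => j _.
by rewrite derive_crossing.
Qed.

Theorem replace_arcs (F2' : L -> L -> R) (u : J -> L -> L -> R) :
    (forall j a b, derive2 act j F2' a b = 0) ->
    (forall a b, F2 a b - F2' a b = \sum_j derive2 act j (u j) a b) ->
  \sum_l (\prod_i arc_tensor F2 i l) * \prod_n node_tensor F3 F4 n l =
  \sum_l (\prod_i arc_tensor F2' i l) * \prod_n node_tensor F3 F4 n l.
Proof.
move=> F2'_inv ex.
apply: (replace_tensors act_anti (node := edge_of hd) (node' := end_node)
  (G := node_tensor F3 F4) _ _ (F := arc_tensor F2) (F' := arc_tensor F2')).
- exact: node_tensor_local.
- exact: node_tensor_inv.
- exact: arc_tensor_local.
- exact: arc_tensor_local.
- exact: arc_tensor_inv.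
- by move=> i j l; rewrite derive_arc F2'_inv.
move=> i; exists (fun j => arc_tensor (u j) i) => [j|l]; first exact: arc_tensor_local.
by rewrite {1 2}/arc_tensor ex; apply: eq_bigr => j _; rewrite derive_arc.
Qed.

End DiagramNetworks.

(** * Tensors over the two systems of labels *)

Definition all_color (P : pred color) : bool :=
  [&& P None, P (Some true) & P (Some false)].

Lemma all_colorP (P : pred color) : reflect (forall c, P c) (all_color P).
Proof.
apply: (iffP and3P) => [[H1 H2 H3]|H]; last by split; apply: H.
by elim/color_ind.
Qed.

Definition all_spin (P : pred spin) : bool :=
  P None && all_color (fun c => P (Some c)).

Lemma all_spinP (P : pred spin) : reflect (forall c, P c) (all_spin P).
Proof.
apply: (iffP andP) => [[H1 /all_colorP H2] [c|]|H] //.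
by split=> //; apply/all_colorP=> c; apply: H.
Qed.

Lemma orient_anti j a b : orient j a b = - orient j b a.
Proof.
apply/eqP; move: b; apply/all_colorP; move: a; apply/all_colorP.
by move: j; apply/all_colorP; lazy.
Qed.

Definition next_color (c : color) : color :=
  match c with None => Some true | Some true => Some false | Some false => None end.

(** For [p] and [q] the colours other than [j], this is the polarization of
    x_p^3 x_q - x_p x_q^3, up to a factor.  The derivatives of these three
    polynomials under the rotations [j] add up to a multiple of the square of the
    norm modulo 5. *)
Definition quartic (j a b c d : color) : F5 :=
  let p := next_color j in let q := next_color p in
  let n (r : color) := ((a == r) + (b == r) + (c == r) + (d == r))%N in
  if (n p == 3) && (n q == 1%N) then 1 else if (n p == 1%N) && (n q == 3) then -1 else 0.

Definition spin_act (j : color) (a b : spin) : F5 :=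
  if a is Some a' then if b is Some b' then orient j a' b' else 0 else 0.

Lemma spin_act_anti j a b : spin_act j a b = - spin_act j b a.
Proof. by case: a b => [a|] [b|] /=; rewrite ?oppr0 // orient_anti. Qed.

Definition spin3 (a b c : spin) : F5 :=
  spin_weight (count_spin a + count_spin b + count_spin c).

Definition spin_crossing : spin -> spin -> spin -> spin -> F5 :=
  local_yamada count_spin spin_weight (-1).

Definition straight (L : eqType) (a b c d : L) : F5 := (a == c)%:R * (b == d)%:R.

Definition spin_quartic (j : color) (a b c d : spin) : F5 :=
  match a, b, c, d with
  | Some a', Some b', Some c', Some d' => quartic j a' b' c' d'
  | _, _, _, _ => 0
  end.

Lemma spin3_inv j a b c : derive3 spin_act j spin3 a b c = 0.
Proof.
rewrite /derive3 !sum_spin.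
apply/eqP; move: c; apply/all_spinP; move: b; apply/all_spinP.
by move: a; apply/all_spinP; move: j; apply/all_colorP; lazy.
Qed.

Lemma spin_crossing_inv j a b c d : derive4 spin_act j spin_crossing a b c d = 0.
Proof.
rewrite /derive4 !sum_spin.
apply/eqP; move: d; apply/all_spinP; move: c; apply/all_spinP; move: b; apply/all_spinP.
by move: a; apply/all_spinP; move: j; apply/all_colorP; lazy.
Qed.

(** On four vectors, the two sides are minus the sum of the three pairings; on
    other spins they vanish. *)
Lemma spin_crossing_straight a b c d :
  spin_crossing a b c d - straight a b c d =
  \sum_j derive4 spin_act j (spin_quartic j) a b c d.
Proof.
rewrite sum_color /derive4 !sum_spin.
apply/eqP; move: d; apply/all_spinP; move: c; apply/all_spinP; move: b; apply/all_spinP.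
by move: a; apply/all_spinP; lazy.
Qed.

Definition pair_color : finType := (color * color)%type.

Lemma sum_pair_color (F : pair_color -> F5) :
  \sum_p F p = \sum_a \sum_b F (a, b).
Proof. by rewrite pair_bigA; apply: eq_bigr => -[]. Qed.

Definition pair_act (j : color) (a b : pair_color) : F5 :=
  orient j a.1 b.1 * (a.2 == b.2)%:R + (a.1 == b.1)%:R * orient j a.2 b.2.

Lemma pair_act_anti j a b : pair_act j a b = - pair_act j b a.
Proof.
rewrite /pair_act (eq_sym b.1) (eq_sym b.2).
by rewrite [orient j a.1 b.1]orient_anti [orient j a.2 b.2]orient_anti; ring.
Qed.

Definition pair3 (a b c : pair_color) : F5 := orient a.1 b.1 c.1 * orient a.2 b.2 c.2.

(** The identity and twice the matrices of the vector product: the factor 2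
    gives all of them the same norm modulo 5. *)
Definition spin_matrix (w : spin) (a : pair_color) : F5 :=
  if w is Some k then 2 * orient k a.1 a.2 else (a.1 == a.2)%:R.

(** The projection of the 3 x 3 matrices onto the sums of a scalar matrix and
    an antisymmetric one; the factor 2 is the inverse of the norm 3 of each
    [spin_matrix]. *)
Definition projector (a b : pair_color) : F5 :=
  2 * \sum_w spin_matrix w a * spin_matrix w b.

Lemma orient_inv j a b c : derive3 orient j orient a b c = 0.
Proof.
rewrite /derive3 !sum_color.
apply/eqP; move: c; apply/all_colorP; move: b; apply/all_colorP; move: a; apply/all_colorP.
by move: j; apply/all_colorP; lazy.
Qed.

Lemma sum_pair_act j a (f g : color -> F5) :
  \sum_p pair_act j p a * (f p.1 * g p.2) =
  (\sum_e orient j e a.1 * f e) * g a.2 + f a.1 * (\sum_e orient j e a.2 * g e).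
Proof.
rewrite sum_pair_color /pair_act !sum_color /=; case: a => a a' /=.
by elim/color_ind: a; elim/color_ind: a' => /=; ring.
Qed.

Lemma pair3_inv j a b c : derive3 pair_act j pair3 a b c = 0.
Proof.
have E := orient_inv j; rewrite /derive3 /pair3.
rewrite (sum_pair_act j a (fun e => orient e b.1 c.1) (fun e => orient e b.2 c.2)).
rewrite (sum_pair_act j b (fun e => orient a.1 e c.1) (fun e => orient a.2 e c.2)).
rewrite (sum_pair_act j c (fun e => orient a.1 b.1 e) (fun e => orient a.2 b.2 e)).
transitivity (derive3 orient j orient a.1 b.1 c.1 * orient a.2 b.2 c.2 +
  orient a.1 b.1 c.1 * derive3 orient j orient a.2 b.2 c.2).
  by rewrite /derive3; ring.
by rewrite !E mul0r mulr0 addr0.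
Qed.

Lemma projector_inv j a b : derive2 pair_act j projector a b = 0.
Proof.
rewrite /derive2 !sum_pair_color !sum_color /projector !sum_spin.
case: a b => [a a'] [b b'].
apply/eqP; move: b'; apply/all_colorP.
move: b; apply/all_colorP; move: a'; apply/all_colorP; move: a; apply/all_colorP.
by move: j; apply/all_colorP; lazy.
Qed.

(** Both sides are a multiple of the sum of the three pairings of the four
    indices of two matrices. *)
Lemma projector_exact a b :
  (a == b)%:R - projector a b =
  \sum_j derive2 pair_act j (fun a b => 2 * quartic j a.1 a.2 b.1 b.2) a b.
Proof.
rewrite sum_color /derive2 !sum_pair_color !sum_color /projector !sum_spin.
case: a b => [a a'] [b b'].
apply/eqP; move: b'; apply/all_colorP.
by move: b; apply/all_colorP; move: a'; apply/all_colorP; move: a; apply/all_colorP; lazy.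
Qed.

Definition contract (w : spin) (f : pair_color -> F5) : F5 :=
  if w is Some k then
    let p := next_color k in let q := next_color p in 2 * (f (p, q) - f (q, p))
  else f (None, None) + f (Some true, Some true) + f (Some false, Some false).

Lemma contractE w (f : pair_color -> F5) :
  \sum_p spin_matrix w p * f p = contract w f.
Proof.
rewrite sum_pair_color !sum_color /spin_matrix.
by case: w => [k|]; [elim/color_ind: k|] => /=; ring.
Qed.

(** Up to scaling, the polarized determinant on the matrices of the spins is the
    cubic form s^3 + s |v|^2. *)
Lemma contract_vertex a b c :
  \sum_p \sum_q \sum_r
    pair3 p q r * (spin_matrix a p * spin_matrix b q * spin_matrix c r) =
  3 * spin3 a b c.
Proof.
transitivity (contract a (fun p => contract b (fun q => contract c (pair3 p q)))).
  rewrite -contractE; apply: eq_bigr => p _.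
  rewrite -contractE mulr_sumr; apply: eq_bigr => q _.
  by rewrite -contractE !mulr_sumr; apply: eq_bigr => r _; ring.
apply/eqP; move: c; apply/all_spinP; move: b; apply/all_spinP.
by move: a; apply/all_spinP; lazy.
Qed.

Lemma contract_crossing a b c d :
  \sum_p \sum_q \sum_r \sum_s straight p q r s *
    (spin_matrix a p * spin_matrix b q * spin_matrix c r * spin_matrix d s) =
  9 * straight a b c d.
Proof.
have E w w' : \sum_p \sum_r (p == r)%:R * (spin_matrix w p * spin_matrix w' r) =
    3 * (w == w')%:R.
  transitivity (\sum_p spin_matrix w p * spin_matrix w' p).
    apply: eq_bigr => p _; rewrite (bigD1 p) //= eqxx mul1r big1 ?addr0 // => r.
    by rewrite eq_sym => /negPf ->; rewrite mul0r.
  rewrite contractE; apply/eqP; move: w'; apply/all_spinP.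
  by move: w; apply/all_spinP; lazy.
transitivity ((\sum_p \sum_r (p == r)%:R * (spin_matrix a p * spin_matrix c r)) *
  (\sum_p \sum_r (p == r)%:R * (spin_matrix b p * spin_matrix d r))).
  rewrite mulr_suml; apply: eq_bigr => p _; rewrite mulr_sumr.
  apply: eq_bigr => q _; rewrite mulr_suml; apply: eq_bigr => r _.
  rewrite mulr_sumr; apply: eq_bigr => s _; rewrite /straight; ring.
by rewrite !E /straight; ring.
Qed.

Section Comparison.
Variable D : diagram.
Hypothesis hrot : is_rotation (@dbase D) (@drot D).
Hypothesis hd : is_matching (@darc D : dend D -> dend D).
Variable corner : dvertex D -> dhalf D.
Hypothesis cornerE : forall v, dbase (corner v) = v.
Hypothesis deg3 : forall v : dvertex D, #|[set h | dbase h == v]| = 3%N.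

Lemma minv_arcs (L : finType) (l : {ffun dend D -> L}) :
  (minv (@darc D) l)%:R = \prod_i arc_tensor (fun a b => (a == b)%:R) i l :> F5.
Proof.
rewrite /arc_tensor (prod_bool _ (fun i => l (val i) == l (darc (val i)))).
congr (nat_of_bool _)%:R; apply/minvP/forallP => [H i|H d]; first by rewrite H.
have /eqP := H (edge_of hd d); rewrite val_edge_of.
by case: ifP => _; rewrite ?(matching_invol hd).
Qed.

Definition network (L : finType) (F3 : L -> L -> L -> F5)
    (F4 : L -> L -> L -> L -> F5) : F5 :=
  \sum_(l : {ffun dend D -> L} | minv (@darc D) l)
    (\prod_v at_corners corner F3 l v) * \prod_x at_crossing F4 l x.

Lemma networkE (L : finType) F3 F4 : network F3 F4 =
  \sum_(l : {ffun dend D -> L}) (\prod_n node_tensor corner F3 F4 n l) *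
     \prod_i arc_tensor (fun a b => (a == b)%:R) i l.
Proof.
rewrite /network big_mkcond; apply: eq_bigr => l _.
rewrite -minv_arcs prod_node_tensor.
by case: (minv _ l); rewrite ?mulr1 ?mulr0.
Qed.

Lemma straight_inv (L J : finType) (act : J -> L -> L -> F5) j a b c d :
  (forall j a b, act j a b = - act j b a) ->
  derive4 act j (@straight L) a b c d = 0.
Proof. by move=> anti; apply: derive4_straight. Qed.

(** Modulo sums of derivatives, the crossings let the spins go straight
    through. *)
Theorem yamada_at_m1 :
  (yamada D (-1 : int))%:~R = 4 ^+ dcircles D * network spin3 (@straight spin).
Proof.
have Q0 : (-1 + 2 + (-1)^-1)%:~R = 0 :> F5 by [].
have cardL : #|{: spin}| = 4%N by rewrite !card_option card_bool.
rewrite (yamada_network (x := count_spin) (t := spin_weight) None) //.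
- rewrite cardL; congr (_ * _).
  transitivity (network spin3 spin_crossing).
    apply: eq_bigr => l _; congr (_ * _).
    apply: eq_bigr => v _; rewrite (big_corners hrot cornerE deg3).
    by rewrite /at_corners /spin3; congr spin_weight; apply: addrA.
  rewrite !networkE.
  apply: (replace_crossings hrot hd cornerE deg3 spin_act_anti _ _ _ (u := spin_quartic)).
  + exact: spin3_inv.
  + exact: spin_crossing_inv.
  + by move=> j a b; apply: derive2_delta; apply: spin_act_anti.
  + by move=> *; apply/straight_inv/spin_act_anti.
  + exact: spin_crossing_straight.
- exact: spin_link.
- by move=> a; rewrite Q0; apply: spin_loop.
- exact: spin0.
- by rewrite cardL Q0; apply/val_inj.
by right.
Qed.

Lemma network_square :
  network orient (@straight color) ^+ 2 = network pair3 (@straight pair_color).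
Proof.
rewrite expr2 !networkE.
pose split_label (k : {ffun dend D -> pair_color}) :
  {ffun dend D -> color} * {ffun dend D -> color} :=
  ([ffun d => (k d).1], [ffun d => (k d).2]).
pose join_label (ll : {ffun dend D -> color} * {ffun dend D -> color}) :
  {ffun dend D -> pair_color} := [ffun d => (ll.1 d, ll.2 d)].
rewrite mulr_suml; under eq_bigr => l _ do rewrite mulr_sumr.
rewrite pair_bigA /= (reindex split_label) /=; last first.
  exists join_label => [k _|[l l'] _].
    by apply/ffunP=> d; rewrite !ffunE -surjective_pairing.
  by congr pair; apply/ffunP=> d; rewrite !ffunE.
apply: eq_bigr => k _; rewrite mulrACA -!big_split /=; congr (_ * _).
  apply: eq_bigr => -[v|x] _; first by rewrite /= /at_corners /pair3 !ffunE.
  have pairE (a b : pair_color) : (a == b)%:R = (a.1 == b.1)%:R * (a.2 == b.2)%:R :> F5.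
    by rewrite -natrM mulnb.
  by rewrite /= /at_crossing /straight !ffunE !pairE; ring.
apply: eq_bigr => i _; rewrite /arc_tensor !ffunE -natrM mulnb.
by congr (nat_of_bool _)%:R.
Qed.

(** With each arc replaced by a sum over the spins, the contraction over pairs
    of colours becomes local. *)
Lemma network_projector :
  network pair3 (@straight pair_color) =
  2 ^+ #|{: edge (@darc D)}| * (3 ^+ #|dvertex D| * 9 ^+ #|crossing D|) *
    network spin3 (@straight spin).
Proof.
rewrite networkE.
under eq_bigr => l _ do rewrite mulrC.
rewrite (replace_arcs hrot hd cornerE deg3 pair_act_anti pair3_inv _ _
  projector_inv projector_exact).
- transitivity (\sum_(k : {ffun dend D -> pair_color})
    2 ^+ #|{: edge (@darc D)}| * \sum_(l : {ffun dend D -> spin} | minv (@darc D) l)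
     (\prod_v at_corners corner (fun p q r => pair3 p q r *
        at_corners corner (fun a b c => spin_matrix a p * spin_matrix b q * spin_matrix c r) l v) k v) *
     \prod_x at_crossing (fun p q r s => straight p q r s *
        at_crossing (fun a b c d => spin_matrix a p * spin_matrix b q *
          spin_matrix c r * spin_matrix d s) l x) k x).
    apply: eq_bigr => k _; rewrite /arc_tensor /projector big_split /= prodr_const.
    rewrite -mulrA; congr (_ * _).
    rewrite (prod_edge_expand hd (fun w d => spin_matrix w (k d))) mulr_suml.
    apply: eq_bigr => l _; rewrite (prod_ends hrot cornerE deg3) prod_node_tensor mulrACA -!big_split /=.
    by congr (_ * _); apply: eq_bigr => n _; apply: mulrC.
  rewrite -mulr_sumr -mulrA; congr (_ * _).
  rewrite exchange_big /= mulr_sumr; apply: eq_bigr => l _.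
  rewrite (sum_local hrot cornerE deg3 (fun v p q r => pair3 p q r *
        at_corners corner (fun a b c => spin_matrix a p * spin_matrix b q * spin_matrix c r) l v)
     (fun x p q r s => straight p q r s *
        at_crossing (fun a b c d => spin_matrix a p * spin_matrix b q *
          spin_matrix c r * spin_matrix d s) l x)).
  rewrite -!prodr_const mulrACA -!big_split /=; congr (_ * _); apply: eq_bigr => n _.
    exact: contract_vertex.
  exact: contract_crossing.
- by move=> *; apply/straight_inv/pair_act_anti.
- by move=> *; apply/derive2_delta/pair_act_anti.
Qed.

End Comparison.

(** * Comparison of the two values *)

Lemma modz5 (a b : int) : a%:~R = b%:~R :> F5 -> (a = b %[mod 5])%Z.
Proof.
move=> E; apply/eqP; rewrite eqz_mod_dvd.
have ch : 5%N \in [pchar F5] by rewrite inE; apply/andP.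
by rewrite (dvdz_pcharf ch) rmorphB /= E subrr.
Qed.

Lemma cubic_half_edges (V H : finType) (base : H -> V) :
  (forall v, #|[set h | base h == v]| = 3%N) -> #|H| = (3 * #|V|)%N.
Proof.
move=> deg3; rewrite -sum1_card (partition_big base predT) //=.
rewrite (eq_bigr (fun=> 3%N)) => [|v _]; first by rewrite sum_nat_const mulnC.
by rewrite -(deg3 v) -sum1_card; apply: eq_bigl => h; rewrite inE.
Qed.

(** A cubic graph has 2 k vertices and 3 k edges.  The constants collected along
    the way are k-th powers, and those of the crossings are powers of 36. *)
Lemma yamada_square (D : diagram) (E : nat) : is_diagram D ->
  (forall v : dvertex D, #|[set h | dbase h == v]| = 3%N) ->
  (2 * E = 3 * #|dvertex D|)%N ->
  (yamada D (-1 : int))%:~R =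
  (-1) ^+ (#|dvertex D| + E) * 3 ^+ E * (yamada D (1 : int))%:~R ^+ 2 :> F5.
Proof.
case=> hrot hd hgenus deg3 hE.
have [corner cornerE] : exists corner : dvertex D -> dhalf D, forall v, dbase (corner v) = v.
  apply: (fin_all_exists (P := fun v h => dbase h = v)) => v.
  have : [set h | dbase h == v] != set0 by rewrite -card_gt0 deg3.
  by case/set0Pn=> h; rewrite inE => /eqP; exists h.
rewrite (yamada_at_m1 hrot hd cornerE deg3) (yamada_at_1 hrot hd hgenus cornerE deg3).
have -> : \sum_(l : {ffun dend D -> color} | minv (@darc D) l)
    (\prod_v at_corners corner orient l v) *
    \prod_x at_crossing (fun a b c d => ((a == c) && (b == d))%:R) l x =
    network corner orient (@straight color).
  apply: eq_bigr => l _; congr (_ * _); apply: eq_bigr => x _.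
  by rewrite /at_crossing /straight -natrM mulnb.
rewrite exprMn (network_square hd).
rewrite (network_projector hrot hd cornerE deg3).
set N := network _ _ _.
have c1 := card_matching hd; rewrite card_sum card_prod card_ord in c1.
rewrite (cubic_half_edges deg3) in c1.
move: c1 hE; set m := #|{: edge _}|; set V := #|dvertex D|; set X := #|crossing D|.
move=> c1 hE.
have [k kE] : exists k, E = (3 * k)%N by exists (E - V)%N; lia.
have -> : V = (2 * k)%N by lia.
have -> : m = (3 * k + 2 * X)%N by lia.
have e1 : (-1) ^+ (2 * k + 3 * k) = (-1) ^+ k :> F5.
  by rewrite -mulnDl exprM; congr (_ ^+ _); apply/val_inj.
have e2 : 3 ^+ (3 * k) = 2 ^+ k :> F5.
  by rewrite exprM; congr (_ ^+ _); apply/val_inj.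
have e3 : 2 ^+ (3 * k + 2 * X) = 3 ^+ k * 4 ^+ X :> F5.
  by rewrite exprD !exprM; congr (_ ^+ _ * _ ^+ _); apply/val_inj.
have e4 : 3 ^+ (2 * k) = 4 ^+ k :> F5.
  by rewrite exprM; congr (_ ^+ _); apply/val_inj.
have e5 : 3 ^+ dcircles D ^+ 2 = 4 ^+ dcircles D :> F5.
  by rewrite exprAC; congr (_ ^+ _); apply/val_inj.
rewrite kE e1 e2 e3 e4 e5.
transitivity ((-1 * 2 * 3 * 4) ^+ k * (4 * 9) ^+ X * (4 ^+ dcircles D * N)).
  have -> : -1 * 2 * 3 * 4 = 1 :> F5 by exact/val_inj.
  have -> : 4 * 9 = 1 :> F5 by exact/val_inj.
  by rewrite !expr1n !mul1r.
by rewrite !exprMn; ring.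
Qed.

Lemma straight_matching : is_matching (fun i : 'I_4 => ordS (ordS i)).
Proof. by split; elim/ord4_ind; rewrite !ordS4E. Qed.

Lemma underlying_edges (D : diagram) : is_matching (@darc D : dend D -> dend D) ->
  (2 * #|gedges (underlying D)| = #|ghalf (underlying D)|)%N.
Proof.
move=> hd; pose p (x : crossing D) : tangle := Some (fun i => ordS (ordS i)).
have hp x g : p x = Some g -> is_matching g by case=> <-; exact: straight_matching.
have hm := strand_mate_matching hd hp.
have := card_gedges (G := resolve p) hm (gedges_resolve hd hp).
by rewrite (card_matching hm) => ->.
Qed.

Lemma underlying_vertices (D : diagram) : #|gvertex (underlying D)| = #|dvertex D|.
Proof.
rewrite card_sum -[RHS]addn0; congr addn.
by apply: eq_card0 => -[x xp].
Qed.

Lemma underlying_degree (D : diagram) : cubic (underlying D) ->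
  forall v : dvertex D, #|[set h | dbase h == v]| = 3%N.
Proof.
move=> cub v; rewrite -(cub (inl v)) /degree -!sum1_card big_sumType /=.
rewrite [X in _ = (_ + X)%N]big1 ?addn0; last by case=> x i; rewrite inE.
by apply: eq_bigl => h; rewrite !inE.
Qed.


(** * Planar graphs as diagrams without crossings *)

Lemma n_comp_bij (T T' : finType) (f : T -> T') (e : rel T) (e' : rel T') :
    bijective f -> connect_sym e -> (forall x y, e' (f x) (f y) = e x y) ->
  n_comp e' predT = n_comp e predT.
Proof.
case=> g fK gK symE ee'.
have conn x y : connect e' (f x) (f y) = connect e x y.
  apply/idP/idP => [|/connectP[p pth ->]].
    case/connectP=> p pth E; apply/connectP; exists (map g p).
      rewrite -(fK x) path_map; apply: sub_path pth => u v uv.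
      by rewrite /= -ee' !gK.
    by rewrite -{1}(fK x) last_map -E fK.
  apply/connectP; exists (map f p); last by rewrite last_map.
  by rewrite path_map; apply: sub_path pth => u v uv; rewrite /= ee'.
have symE' : connect_sym e' by move=> x y; rewrite -(gK x) -(gK y) !conn symE.
rewrite -!card_components //.
have -> : components e' = (fun C : {set T} => f @: C) @: components e.
  have img x : component e' (f x) = f @: component e x.
    apply/setP=> y; rewrite inE -(gK y) conn mem_imset ?inE //; exact: can_inj fK.
  apply/setP=> C; apply/imsetP/imsetP => [[x _ ->]|[C' /imsetP[x _ ->] ->]].
    by exists (component e (g x)); rewrite ?mem_components // -img gK.
  by exists (f x); rewrite ?img.
by rewrite card_imset //; apply/imset_inj/can_inj/fK.
Qed.

Section PlanarGraph.
Variables (G : graph) (rot mate : ghalf G -> ghalf G).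
Hypotheses (hrot : is_rotation (@gbase G) rot) (hm : is_matching mate).
Hypothesis edgesE : gedges G = [set [set h; mate h] | h : ghalf G].
Hypothesis hgenus : genus0 rot mate.

Definition plane_diagram : diagram :=
  @Diagram (gvertex G) (ghalf G) (@gbase G) rot void
    (fun d => match d with inl h => inl (mate h) | inr (x, i) => inr (x, i) end)
    (gcircles G).

Let D := plane_diagram.
Let into (h : ghalf G) : dend D := inl h.

Let into_bij : bijective into.
Proof.
by exists (fun d : dend D => match d with inl h => h | inr (x, _) => match x with end end);
  [|case=> [h|[[]]]].
Qed.

Lemma plane_matching : is_matching (@darc D : dend D -> dend D).
Proof.
split; case=> [h|[[]]] //=; first by rewrite (matching_invol hm).
by apply/eqP => -[] /eqP; rewrite (negPf (matching_neq hm h)).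
Qed.

Lemma plane_diagramP : is_diagram D.
Proof.
have ri : injective rot by exact: (drot_inj (D := D) hrot).
have mi := matching_inj hm.
split; [exact: hrot|exact: plane_matching|].
have inE' h h' : (into h == into h') = (h == h') by apply/eqP/eqP => [[]|->].
have cf (s : ghalf G -> ghalf G) (s' : dend D -> dend D) :
    injective s -> (forall h, s' (into h) = into (s h)) -> fcard s' predT = fcard s predT.
  move=> si ss; apply: (n_comp_bij into_bij (fconnect_sym si)) => x y.
  by rewrite /= ss inE'.
move: hgenus; rewrite /genus0.
rewrite (cf rot) // (cf mate) // (cf (rot \o mate)) //; last exact: inj_comp.
rewrite (bij_eq_card into_bij).
rewrite (n_comp_bij (e := [rel x y | (y == rot x) || (y == mate x)]) into_bij) //.
  have := map_rel_sym (perm ri) (perm mi) => sym x y.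
  by have := sym x y; rewrite !(eq_connect (e' := [rel x y | (y == rot x) || (y == mate x)])) //
    => u v; rewrite /map_rel /= !permE.
Qed.

Lemma plane_yamada (R : comNzRingType) (M : nmodType) (L : finType) (x : L -> M)
    (l0 : L) (t : M -> R) (q : int) :
  (forall a b, \sum_l t (a + x l) * t (b + x l) = t (a + b) + t a * t b) ->
  (forall a, \sum_l t (a + x l + x l) = (1 - (q + 2 + q^-1)%:~R) * t a) ->
  t 0 = -1 -> #|L|%:R = (q + 2 + q^-1)%:~R - 1 :> R -> q = 1 \/ q = -1 ->
  (yamada D q)%:~R =
  ((-1) ^+ (#|gvertex G| + #|gedges G|) * (flow_poly G).[q + 2 + q^-1])%:~R :> R.
Proof.
move=> t_link t_loop t0 cL hq.
rewrite (yamada_network l0 t_link t_loop t0 cL plane_matching hq).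
rewrite (flow_network t_link t_loop t0 hm edgesE l0) -cL; congr (_ * _).
rewrite (reindex (fun l : {ffun ghalf G -> L} => [ffun d : dend D => match d with
    | inl h => l h | inr (x, _) => match x with end end])) /=; last first.
  exists (fun l : {ffun dend D -> L} => [ffun h => l (inl h)]) => l _.
    by apply/ffunP=> h; rewrite !ffunE.
  by apply/ffunP=> -[h|[[]]]; rewrite !ffunE.
apply: eq_big => [l|l _].
  by apply/minvP/minvP => [H h|H [h|[[]]]]; [have := H (inl h)|]; rewrite !ffunE.
rewrite [X in _ * X]big1 ?mulr1; last by case.
apply: eq_bigr => v _; congr t; apply: eq_bigr => h _; by rewrite ffunE.
Qed.

End PlanarGraph.

Theorem lemma4p1 :
  (forall G : graph, is_graph G -> planar G -> cubic G ->
     ((flow_poly G).[0] = 3 ^+ #|gedges G| * (flow_poly G).[4] ^+ 2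
        %[mod 5])%Z) /\
  (forall D : diagram, is_diagram D -> cubic (underlying D) ->
     let V := #|gvertex (underlying D)| in
     let E := #|gedges (underlying D)| in
     (yamada D (-1 : int) =
        (-1) ^ (V%:Z - E%:Z) * 3 ^+ E * yamada D (1 : int) ^+ 2
        %[mod 5])%Z).
Proof.
split=> [G _ [rot [mate [hrot hm edgesE hgenus]]] cub|D hD cub V E].
  set D := plane_diagram rot mate.
  have hD : is_diagram D by exact: plane_diagramP.
  have hE : (2 * #|gedges G| = 3 * #|gvertex G|)%N.
    by rewrite (card_gedges hm edgesE) -(card_matching hm) (cubic_half_edges cub).
  have := yamada_square hD cub hE.
  have card3 : #|color| = 3%N by rewrite !card_option card_bool.
  have card4 : #|{: spin}| = 4%N by rewrite card_option card3.
  have ym1 := plane_yamada rot hm edgesE None (q := -1) spin_link spin_loop spin0.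
  have y1 := plane_yamada rot hm edgesE None (q := 1) parity_link parity_loop parity0.
  rewrite ym1; [|by rewrite card4; apply/val_inj|by right].
  rewrite y1; [|by rewrite card3; apply/val_inj|by left].
  have -> : -1 + 2 + (-1)^-1 = (0 : int)%R by [].
  have -> : 1 + 2 + 1^-1 = (4 : int)%R by [].
  set s := (-1) ^+ _; have sE : s%:~R = (-1) ^+ (#|gvertex G| + #|gedges G|) :> F5.
    by rewrite rmorphXn /= rmorphN1.
  rewrite !rmorphM /= -sE exprMn sE sqrr_sign mul1r -mulrA => /(congr1 ( *%R s%:~R)).
  rewrite -sE !mulrA -expr2 sE sqrr_sign !mul1r => H.
  by apply: modz5; rewrite H !rmorphM rmorphXn.
have [hrot hd hgenus] := hD.
have deg3 := underlying_degree cub.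
have hE : (2 * E = 3 * #|dvertex D|)%N.
  rewrite /E underlying_edges // -underlying_vertices.
  exact: cubic_half_edges cub.
apply: modz5; rewrite (yamada_square hD deg3 hE) signr_exprz !rmorphM !rmorphXn /=.
by rewrite rmorphN1 /V underlying_vertices.
Qed.
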